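(* (i) The variety $\mathbb{E}^1$ is hereditarily finitely based. (ii) Every proper subvariety of $\mathbb{E}^1\{\sigma_\infty\}$ is Cross. (iii) The variety $\mathbb{E}^1\{\sigma_\infty\}$ is the only non-finitely generated subvariety of $\mathbb{E}^1$.
   Context: Monoids are algebras in the signature $\{\cdot,1\}$; a monoid variety is a class of monoids defined by a set of identities. $\mathbb{E}^1$ is the monoid variety generated by the monoid $E^1=E\cup\{1\}$ obtained by adjoining an identity to the semigroup (with zero $0$) $E=\langle a,b,c\mid a^2=ab=0,\ ba=ca=a,\ b^2=bc=b,\ c^2=cb=c\rangle$ of order five. $\mathbb{E}^1\{\sigma_\infty\}$ is the subvariety of $\mathbb{E}^1$ defined by the identity $\sigma_\infty:\ x^2y^2hx^2y^2\approx x^2y^2hy^2x^2$. A variety is finitely based if it is defined by finitely many identities, hereditarily finitely based if all its subvarieties are finitely based, finitely generated if it is generated by a finite algebra, and small if it has only finitely many subvarieties; it is Cross if it is finitely based, finitely generated and small. *)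

(* Defs.v *)
From HB Require Import structures.
From mathcomp Require Import all_boot.

Set Implicit Arguments.
Unset Strict Implicit.
Unset Printing Implicit Defensive.

Local Open Scope group_scope.

(* Words over the countably infinite alphabet nat; the empty word is 1. *)
Definition word := seq nat.
Definition identity := (word * word)%type.

Definition eval (M : monoidType) (phi : nat -> M) (w : word) : M :=
  \prod_(i <- w) phi i.

Definition satisfies (M : monoidType) (e : identity) : Prop :=
  forall phi : nat -> M, eval phi e.1 = eval phi e.2.

Definition monoid_class := monoidType -> Prop.

Definition same_class (V W : monoid_class) : Prop := forall M, V M <-> W M.

Definition models (Sigma : identity -> Prop) : monoid_class :=
  fun M => forall e, Sigma e -> satisfies M e.

Definition is_variety (V : monoid_class) : Prop :=
  exists Sigma : identity -> Prop, same_class V (models Sigma).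

Definition subvariety (W V : monoid_class) : Prop :=
  is_variety W /\ (forall M, W M -> V M).

Definition proper_subvariety (W V : monoid_class) : Prop :=
  subvariety W V /\ ~ same_class W V.

(* The smallest variety containing M; see is_variety_generated. *)
Definition generated_variety (M : monoidType) : monoid_class :=
  fun N => forall V, is_variety V -> V M -> V N.

Definition defined_within (V : monoid_class) (e : identity) : monoid_class :=
  fun M => V M /\ satisfies M e.

Definition finitely_based (V : monoid_class) : Prop :=
  exists s : seq identity, same_class V (models (fun e => e \in s)).

Definition hereditarily_finitely_based (V : monoid_class) : Prop :=
  forall W, subvariety W V -> finitely_based W.

Definition finite_monoid (M : monoidType) : Prop :=
  exists s : seq M, forall x, x \in s.

Definition finitely_generated (V : monoid_class) : Prop :=
  exists2 M : monoidType, finite_monoid M & same_class V (generated_variety M).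

Definition small (V : monoid_class) : Prop :=
  exists (n : nat) (F : 'I_n -> monoid_class),
    forall W, subvariety W V -> exists i, same_class W (F i).

Definition cross (V : monoid_class) : Prop :=
  [/\ finitely_based V, finitely_generated V & small V].

Lemma is_variety_generated (M : monoidType) : is_variety (generated_variety M).
Proof.
exists (fun e => satisfies M e) => N; split=> [genN e Me|MN V [S VS] VM].
  by apply: (genN (fun K => satisfies K e)) => //; exists (eq e) => K;
    split=> [Ke _ <- //|]; apply.
by apply/VS => e Se; apply: MN; move/VS: VM; apply.
Qed.

Lemma is_variety_defined_within (V : monoid_class) (e : identity) :
  is_variety V -> is_variety (defined_within V e).
Proof.
move=> [S VS]; exists (fun e' => S e' \/ e' = e) => M; split.
  by move=> [/VS SM Me] e' [/SM //|->].
move=> SM; split; last by apply: SM; right.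
by apply/VS => e' Se'; apply: SM; left.
Qed.

(* The semigroup obtained from S by adjoining a new identity, None. *)
Definition adjoin1 (S : semigroupType) : Type := option S.

Section Adjoin1.
Variable S : semigroupType.

HB.instance Definition _ := Choice.on (adjoin1 S).

Definition adjoin1_mul (u v : adjoin1 S) : adjoin1 S :=
  match u, v with
  | None, _ => v
  | _, None => u
  | Some x, Some y => Some (x * y)
  end.

Fact adjoin1_mulA : associative adjoin1_mul.
Proof. by case=> [x|] [y|] [z|] //=; rewrite mulgA. Qed.

Fact adjoin1_mul1 : left_id None adjoin1_mul.
Proof. by case. Qed.

Fact adjoin1_1mul : right_id None adjoin1_mul.
Proof. by case. Qed.

HB.instance Definition _ :=
  isMonoid.Build (adjoin1 S) adjoin1_mulA adjoin1_mul1 adjoin1_1mul.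

End Adjoin1.

(* The semigroup with zero
     E = < a, b, c | a^2 = ab = 0, ba = ca = a, b^2 = bc = b, c^2 = cb = c >,
   on the normal forms a, b, c, ac, 0 of its five elements. That the table
   below is the one given by the presentation is E_presentation. *)
Inductive E : Type := Ea | Eb | Ec | Eac | E0.

Definition E_mul (x y : E) : E :=
  match x, y with
  | E0, _ | _, E0 => E0
  | (Eb | Ec), (Ea | Eac) => y
  | (Eb | Ec), _ => x
  | _, (Ea | Eac) => E0
  | Ea, Eb => E0
  | Ea, _ => Eac
  | Eac, _ => Eac
  end.

Definition E_code (x : E) : 'I_5 :=
  inord match x with Ea => 0 | Eb => 1 | Ec => 2 | Eac => 3 | E0 => 4 end.

Definition E_decode (i : 'I_5) : E := nth E0 [:: Ea; Eb; Ec; Eac; E0] i.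

Fact E_codeK : cancel E_code E_decode.
Proof. by case; rewrite /E_decode inordK. Qed.

HB.instance Definition _ := Finite.copy E (can_type E_codeK).

Fact E_mulA : associative E_mul.
Proof. by do 3!case. Qed.

HB.instance Definition _ := isSemigroup.Build E E_mulA.

Definition is_zero (S : semigroupType) (z : S) : Prop :=
  forall x : S, z * x = z /\ x * z = z.

Definition E_relations (S : semigroupType) (z a b c : S) : Prop :=
  [/\ a * a = z /\ a * b = z, b * a = a /\ c * a = a,
      b * b = b /\ b * c = b & c * c = c /\ c * b = c].

Lemma E0_zero : is_zero E0.
Proof. by case. Qed.

Lemma E_relations_E : E_relations E0 Ea Eb Ec.
Proof. by []. Qed.

Lemma E_presentation (S : semigroupType) (z a b c : S) :
    is_zero z -> E_relations z a b c ->
  let hom (f : E -> S) :=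
    {morph f : x y / x * y} /\ [/\ f E0 = z, f Ea = a, f Eb = b & f Ec = c] in
  exists2 f : E -> S, hom f & forall g, hom g -> g =1 f.
Proof.
move=> z0 [[aa ab] [ba ca] [bb bc] [cc cb]] hom.
have zl x : z * x = z by case: (z0 x).
have zr x : x * z = z by case: (z0 x).
pose f x := match x with
  Ea => a | Eb => b | Ec => c | Eac => a * c | E0 => z end.
exists f; last first.
  move=> g [gM [g0 ga gb gc]] [] //=.
  by rewrite -[Eac]/(Ea * Ec : E) gM ga gc.
split=> //; case; case; rewrite /= ?zl ?zr ?aa ?ab ?ba ?ca ?bb ?bc ?cc ?cb //;
  rewrite ?mulgA ?aa ?ab ?ba ?ca ?zl //;
  by rewrite -?mulgA ?cc ?cb // ?[c * (a * c)]mulgA ?ca ?aa // ?mulgA ?aa ?zl.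
Qed.

Lemma E_card : #|{: E}| = 5.
Proof.
rewrite -(card_ord 5); apply: (bij_eq_card (f := E_code)); exists E_decode.
  exact: E_codeK.
by case=> -[|[|[|[|[|//]]]]] i; apply: val_inj; rewrite /= inordK.
Qed.

Definition E1 : monoidType := adjoin1 E.

Definition EE1 : monoid_class := generated_variety E1.

(* x^2 y^2 h x^2 y^2 = x^2 y^2 h y^2 x^2 with x, y, h the letters 0, 1, 2. *)
Definition sigma_infty : identity :=
  let x := 0%N in let y := 1%N in let h := 2%N in
  ([:: x; x; y; y; h; x; x; y; y], [:: x; x; y; y; h; y; y; x; x]).

Definition EE1_sigma_infty : monoid_class := defined_within EE1 sigma_infty.

(* Main.v *)
(* In the variety of E^1 a letter that occurs at least twice in a word may be
   evaluated at idempotents only, and idempotents satisfy e f e = e f. A word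
   thus amounts to a sequence of letters occurring once, separated by blocks of
   repeated letters, where a block only remembers its letters in the order of
   their first occurrences.
     Given an identity u = v of a subvariety V, compare u and v. If they differ
   in the letters, in the letters occurring once, in the order of the latter, or
   in the contents of a block, then substituting for all but one or two letters
   yields one of six short identities, each of which implies
   e t e s e = e t s e. If they only differ in the order of letters x, y in a
   block, they yield
     sigma_n : x^2 h_1 y^2 h_2 x^2 ... h_n x^2 y^2 = ... y^2 x^2,
   where n counts the alternations of x and y in the preceding blocks, or
   sigma_oo when x and y lie in a common preceding block. Conversely, all these
   consequences together imply u = v, by filling the blocks and bubble sort.
   Each of the six identities implies sigma_1, and sigma_n implies sigma_(n+1)
   and sigma_oo. So V is E^1, or E^1{sigma_oo}, or satisfies some sigma_n, in
   which case it has finitely many subvarieties.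
     A subvariety of E^1 with finitely many subvarieties is generated by its
   relatively free monoid over enough letters, which is finite. A finite monoid
   satisfying sigma_oo satisfies some sigma_n by the pigeonhole principle,
   whereas for each n an automaton yields a monoid in E^1{sigma_oo} that fails
   sigma_n. *)
From HB Require Import structures.
Require Import Defs.
From mathcomp Require Import all_boot.
From mathcomp Require Import boolp zify.

Set Implicit Arguments.
Unset Strict Implicit.
Unset Printing Implicit Defensive.

Local Open Scope group_scope.

(** * Words evaluated in monoids with the identities of E^1 *)

Section Eval.
Variables (M : monoidType) (phi : nat -> M).

Lemma eval_nil : eval phi [::] = 1.
Proof. exact: big_nil. Qed.

Lemma eval_cons x w : eval phi (x :: w) = phi x * eval phi w.
Proof. exact: big_cons. Qed.

Lemma eval_cat u v : eval phi (u ++ v) = eval phi u * eval phi v.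
Proof. exact: big_cat. Qed.

Lemma eval_seq1 x : eval phi [:: x] = phi x.
Proof. exact: big_seq1. Qed.

Lemma eq_in_eval psi w : {in w, phi =1 psi} -> eval phi w = eval psi w.
Proof. by move=> eq_w; apply: eq_big_seq. Qed.

End Eval.

Definition evalE :=
  (@eval_cat, @eval_cons, @eval_nil, @mulg1, @mul1g, @mulgA).

(** These three identities are shown in [EE1P] to axiomatise the variety of E^1. *)
Definition EE1_basis : seq identity :=
  [:: ([:: 0; 1; 0], [:: 0; 0; 1; 0; 0]); ([:: 0; 0; 0], [:: 0; 0]);
      ([:: 0; 0; 1; 1; 0; 0], [:: 0; 0; 1; 1])]%N.

Definition basic : monoid_class := models (fun e => e \in EE1_basis).

Definition idem (M : monoidType) (e : M) := e * e = e.

Lemma idem1 (M : monoidType) : idem (1 : M).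
Proof. exact: mul1g. Qed.

Section Basic.
Variable M : monoidType.
Hypothesis bM : basic M.
Implicit Types (e f : M) (phi : nat -> M) (b u v w : word).

Lemma basic_sandwich (x h : M) : x * h * x = x * x * h * x * x.
Proof.
have /bM/(_ (nth 1 [:: x; h])) :
  ([:: 0; 1; 0], [:: 0; 0; 1; 0; 0])%N \in EE1_basis by [].
by rewrite !evalE.
Qed.

Lemma basic_cube (x : M) : x * x * x = x * x.
Proof.
have /bM/(_ (nth 1 [:: x])) :
  ([:: 0; 0; 0], [:: 0; 0])%N \in EE1_basis by [].
by rewrite !evalE.
Qed.

Lemma idem_sq (x : M) : idem (x * x).
Proof. by rewrite /idem mulgA basic_cube basic_cube. Qed.

Lemma idem_absorb e f : idem e -> idem f -> e * f * e = e * f.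
Proof.
move=> ee ff; have /bM/(_ (nth 1 [:: e; f])) :
  ([:: 0; 0; 1; 1; 0; 0], [:: 0; 0; 1; 1])%N \in EE1_basis by [].
rewrite !evalE /= !ee -(mulgA _ f f) ff -(mulgA _ e e) ee.
by [].
Qed.

Lemma idemM e f : idem e -> idem f -> idem (e * f).
Proof. by move=> ee ff; rewrite /idem mulgA idem_absorb // -mulgA ff. Qed.

Lemma idem_eval phi w : (forall z, z \in w -> idem (phi z)) -> idem (eval phi
  w).
Proof.
elim: w => [|x w IHw] id_w; first by rewrite eval_nil; apply: idem1.
rewrite eval_cons; apply: idemM; first by apply: id_w; rewrite mem_head.
by apply: IHw => z wz; apply: id_w; rewrite inE wz orbT.
Qed.

(** The part of w behind an occurrence of x is again idempotent, and e f e = e f. This is why a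
    block keeps only first occurrences. *)
Lemma eval_absorb phi w x :
    (forall z, z \in w -> idem (phi z)) -> x \in w ->
  eval phi w * phi x = eval phi w.
Proof.
move=> id_w /splitPr def_w; case: def_w id_w => w1 w2 id_w.
rewrite eval_cat eval_cons -!mulgA; congr (_ * _).
rewrite mulgA idem_absorb //; first by apply: id_w; rewrite mem_cat mem_head
  orbT.
by apply: idem_eval => z wz; apply: id_w; rewrite mem_cat inE wz !orbT.
Qed.

Lemma eval_absorb_pair phi e f w :
    idem e -> idem f ->
    (forall z, z \in w -> [\/ phi z = e, phi z = f | phi z = 1]) ->
  e * f * eval phi w = e * f.
Proof.
move=> ee ff; elim: w => [|x w IHw] vals; first by rewrite eval_nil mulg1.
have {}IHw : e * f * eval phi w = e * f.
  by apply: IHw => z wz; apply: vals; rewrite inE wz orbT.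
rewrite eval_cons mulgA; have [->|->|->] := vals x (mem_head _ _).
- by rewrite idem_absorb.
- by rewrite -(mulgA e) ff.
- by rewrite mulg1.
Qed.

Definition square_off (S : pred nat) phi x :=
  if S x then phi x else phi x * phi x.

Lemma idem_square_off S phi x : ~~ S x -> idem (square_off S phi x).
Proof. by rewrite /square_off => /negPf ->; apply: idem_sq. Qed.

Lemma sandwich_squarer (x h : M) : x * x * h * x = x * x * h * x * x.
Proof.
have := congr1 (fun y => x * y) (basic_sandwich x h); rewrite /= !mulgA =>
  {1}->.
by rewrite basic_cube.
Qed.

Lemma sandwich_squarel (x h : M) : x * h * x = x * x * h * x.
Proof. by rewrite sandwich_squarer -basic_sandwich. Qed.

(** Values of repeated letters may be squared, hence taken idempotent. The letters are treated from
    left to right, each with the help of another occurrence. *)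
Lemma eval_square_off (S : pred nat) phi w :
    (forall z, z \in w -> ~~ S z -> 1 < count_mem z w) ->
  eval phi w = eval (square_off S phi) w.
Proof.
move=> mult.
suff pref p : forall q, w = p ++ q ->
    eval phi w = eval (square_off S phi) p * eval phi q.
  by rewrite (pref w [::]) ?cats0 // eval_nil mulg1.
elim/last_ind: p => [|p x IHp] q def_w; first by rewrite def_w !evalE.
rewrite cat_rcons in def_w; rewrite (IHp _ def_w) -cats1 eval_cat eval_seq1.
rewrite eval_cons mulgA; have [Sx|nSx] := boolP (S x).
  by rewrite [square_off S phi x]/square_off Sx.
have sqx : square_off S phi x = phi x * phi x.
  by rewrite /square_off (negPf nSx).
have: x \in p ++ q.
  have wx: x \in w by rewrite def_w mem_cat mem_head orbT.
  have:= mult x wx nSx; rewrite def_w count_cat /= eqxx addnCA add1n -count_cat.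
  by rewrite ltnS -has_count has_pred1.
(* Another occurrence of x lies to the left, where its value is already squared, or to the right,
   where it is not yet. *)
rewrite mem_cat => /orP[] /splitPr [w1 w2].
  rewrite eval_cat eval_cons sqx; congr (_ * _).
  rewrite -!mulgA; congr (_ * _); rewrite !mulgA.
  exact: sandwich_squarer.
rewrite sqx eval_cat eval_cons -!mulgA; congr (_ * _); rewrite !mulgA.
congr (_ * _); exact: sandwich_squarel.
Qed.

End Basic.

(** * Words cut into blocks *)

(* blockw B T m is the word B 0 . T 0 . B 1 . T 1 ... T (m - 1) . B m, where the
   T k will be the letters occurring once and the B k the blocks; prefw and
     suffw
   are the parts before and after the block B i. *)
Definition prefw (B : nat -> word) (T : nat -> nat) i : word :=
  \big[cat/[::]]_(0 <= k < i) (B k ++ [:: T k]).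

Definition suffw (B : nat -> word) (T : nat -> nat) i m : word :=
  \big[cat/[::]]_(i <= k < m) (T k :: B k.+1).

Definition blockw B T m : word := prefw B T m ++ B m.

Section Segments.
Variable T : nat -> nat.
Implicit Types (B : nat -> word) (i k m z : nat).

Lemma prefw0 B : prefw B T 0 = [::].
Proof. exact: big_geq. Qed.

Lemma prefwS B i : prefw B T i.+1 = prefw B T i ++ B i ++ [:: T i].
Proof. exact: big_nat_recr. Qed.

Lemma prefwSl B i :
  prefw B T i.+1 = B 0 ++ T 0 :: prefw (fun k => B k.+1) (fun k => T k.+1) i.
Proof. by rewrite /prefw big_nat_recl // -catA. Qed.

Lemma suffw_geq B i m : m <= i -> suffw B T i m = [::].
Proof. exact: big_geq. Qed.

Lemma suffw_ltn B i m : i < m -> suffw B T i m = T i :: B i.+1 ++ suffw B T i.+1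
  m.
Proof. by move=> lt_im; rewrite /suffw big_ltn. Qed.

Lemma blockw_split B i m : i <= m -> blockw B T m = prefw B T i ++ B i ++ suffw
  B T i m.
Proof.
move=> le_im; rewrite -(subnKC le_im); elim: (m - i) => [|d IHd].
  by rewrite addn0 suffw_geq // cats0.
rewrite addnS /blockw prefwS -!catA; rewrite /blockw catA in IHd; rewrite catA
  IHd.
by rewrite -!catA /suffw big_nat_recr ?leq_addr //= -catA.
Qed.

Lemma mem_prefwP B i z :
  z \in prefw B T i ->
  (exists2 k, k < i & z \in B k) \/ (exists2 k, k < i & z = T k).
Proof.
elim: i => [|i IHi]; first by rewrite prefw0.
rewrite prefwS !mem_cat mem_seq1 => /or3P[/IHi[]|zB|/eqP->].
- by case=> k lt_ki zB; left; exists k => //; apply: ltnW.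
- by case=> k lt_ki zB; right; exists k => //; apply: ltnW.
- by left; exists i.
- by right; exists i.
Qed.

Lemma mem_suffwP B i m z :
  z \in suffw B T i m ->
  (exists2 k, i < k <= m & z \in B k) \/ (exists2 k, i <= k < m & z = T k).
Proof.
elim: m => [|m IHm]; first by rewrite suffw_geq.
case: (leqP i m) => [le_im|lt_mi]; last by rewrite suffw_geq.
rewrite /suffw big_nat_recr //= mem_cat inE => /or3P[/IHm[]|/eqP->|zB].
- case=> k /andP[lt_ik le_km] zB; left; exists k => //.
  by rewrite lt_ik leqW.
- case=> k /andP[le_ik lt_km] ->; right; exists k => //.
  by rewrite le_ik leqW.
- by right; exists m => //; rewrite le_im ltnSn.
- by left; exists m.+1 => //; rewrite ltnS le_im leqnn.
Qed.

Lemma mem_suffw B i m k z : i < k <= m -> z \in B k -> z \in suffw B T i m.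
Proof.
elim: m => [|m IHm] /andP[lt_ik]; first by rewrite leqNgt (leq_trans _ lt_ik).
move=> le_km zB; have le_im : i <= m by rewrite -ltnS (leq_trans lt_ik).
rewrite /suffw big_nat_recr //= mem_cat inE.
move: le_km; rewrite leq_eqVlt => /predU1P[<-|lt_km]; first by rewrite zB !orbT.
by rewrite -/(suffw B T i m) IHm // lt_ik.
Qed.

(** Passes from [B] to [B'] one block at a time, through words with the blocks of [B] before
    position i and those of [B'] after it. *)
Lemma eval_hybrid (M : monoidType) (phi : nat -> M) B B' m :
    (forall i, i <= m ->
      eval phi (prefw B T i ++ B i ++ suffw B' T i m) =
      eval phi (prefw B T i ++ B' i ++ suffw B' T i m)) ->
  eval phi (blockw B T m) = eval phi (blockw B' T m).
Proof.
move=> step.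
have walk i : i <= m ->
    eval phi (blockw B' T m) = eval phi (prefw B T i ++ B' i ++ suffw B' T i m).
  elim: i => [_|i IHi lt_im]; first by rewrite (blockw_split B' (leq0n m))
    !prefw0.
  rewrite IHi 1?ltnW // -step 1?ltnW // (suffw_ltn _ lt_im) prefwS.
  by congr (eval _ _); rewrite -!catA.
by rewrite (walk m) // -step // suffw_geq // cats0.
Qed.

End Segments.

Lemma block_decomposition (S : pred nat) (u : word) :
  exists2 B, u = blockw B (nth 0 (filter S u)) (size (filter S u)) &
    forall k z, z \in B k -> (z \in u) && ~~ S z.
Proof.
elim: u => [|x u [B def_u BuS]] /=.
  by exists (fun=> [::]) => //; rewrite /blockw prefw0.
case: ifPn => Sx /=.
  exists (fun k => if k is k'.+1 then B k' else [::]) => [|[|k] //= z zB].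
    by rewrite /blockw prefwSl /= -[LHS]/(x :: u) {1}def_u.
  by have /andP[zu ->] := BuS k z zB; rewrite inE zu orbT.
exists (fun k => if k is k'.+1 then B k else x :: B 0).
  rewrite /blockw {1}def_u; case: (size _) => [|n]; first by rewrite /blockw
    !prefw0.
  by rewrite /blockw !prefwSl.
move=> [|k] z; last by move=> /BuS/andP[zu ->]; rewrite inE zu orbT.
rewrite inE => /predU1P[->|/BuS/andP[zu ->]]; rewrite inE ?eqxx ?Sx //.
by rewrite zu orbT.
Qed.

(** * Short identities and differences in content *)

(* Since the squares of a basic monoid are its idempotents, the identities below
   are stated with idempotents instead of squares. *)
Definition gap_fill : monoid_class :=
  fun M => forall e t s : M, idem e -> e * t * e * s * e = e * t * s * e.
Definition right_fill : monoid_class :=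
  fun M => forall e t : M, idem e -> e * t * e = e * t.
Definition left_fill : monoid_class :=
  fun M => forall e t : M, idem e -> e * t * e = t * e.
Definition sigma_inf : monoid_class :=
  fun M => forall e f h : M, idem e -> idem f ->
    e * f * h * e * f = e * f * h * f * e.

(** The product e h_1 f h_2 e h_3 ... that precedes the exchanged factors in sigma_n. *)
Fixpoint alt (M : monoidType) (e f : M) (hs : seq M) : M :=
  if hs is h :: hs' then e * h * alt f e hs' else 1.

Definition sigma n : monoid_class :=
  fun M => forall (e f : M) hs, idem e -> idem f -> size hs = n ->
    alt e f hs * e * f = alt e f hs * f * e.

Section Assign.
Variables (M : monoidType) (ts : seq nat).
Hypothesis ts_uniq : uniq ts.

(** Isolates one or two repeated letters while [w] controls the separators. Since x is tested first,
    a single letter is isolated by taking y = x and f = 1. *)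
Definition assign (e f : M) (x y : nat) (w : nat -> M) (z : nat) : M :=
  if z \in ts then w (index z ts)
  else if z == x then e else if z == y then f else 1.

Lemma assign_nth e f x y w k : k < size ts -> assign e f x y w (nth 0 ts k) = w
  k.
Proof. by move=> lt_k; rewrite /assign mem_nth // index_uniq. Qed.

End Assign.

Section Consequences.
Variables (S : pred nat) (ts : seq nat).
Hypotheses (ts_uniq : uniq ts) (ts_S : forall z, z \in ts -> S z).
Local Notation T := (nth 0 ts).
Local Notation m := (size ts).

Definition avoids (B : nat -> word) := forall k z, z \in B k -> ~~ S z.

(** Only idempotent values are tried off [S]; by [eval_square_off] this is enough when the letters
    off [S] occur at least twice. *)
Definition agree (M : monoidType) (B B' : nat -> word) :=
  forall phi : nat -> M, (forall z, ~~ S z -> idem (phi z)) ->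
    eval phi (blockw B T m) = eval phi (blockw B' T m).

Lemma agree_sym (M : monoidType) B B' : agree M B B' -> agree M B' B.
Proof. by move=> agM phi /agM ->. Qed.

Lemma avoids_ts B k z : avoids B -> z \in B k -> (z \in ts) = false.
Proof. by move=> offB /offB; apply: contraNF => /ts_S. Qed.

Variables (M : monoidType) (bM : basic M).
Implicit Types (e f t s h : M) (B : nat -> word) (w : nat -> M).

Lemma idem_assign e f x y w z :
  idem e -> idem f -> ~~ S z -> idem (assign ts e f x y w z).
Proof.
move=> ee ff nSz; rewrite /assign; case: ifPn => [/ts_S Sz|_]; first by rewrite
  Sz in nSz.
by do 2?[case: ifP => // _]; apply: idem1.
Qed.

Lemma eval_single (phi : nat -> M) e x u :
    idem e -> (forall z, z \in u -> phi z = if z == x then e else 1) ->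
  eval phi u = if x \in u then e else 1.
Proof.
move=> ee; elim: u => [|y u IHu] vals; first by rewrite eval_nil.
rewrite eval_cons IHu => [|z zu]; last by apply: vals; rewrite inE zu orbT.
rewrite vals ?mem_head // inE eq_sym; case: eqP => [->|_] /=; last exact: mul1g.
by case: ifP; rewrite ?mulg1.
Qed.

Lemma assign_prefw e f x y w i B z :
    avoids B -> i <= m -> (forall k, k < i -> w k = 1) -> z \in prefw B T i ->
  assign ts e f x y w z = (if z == x then e else if z == y then f else 1) \/
  assign ts e f x y w z = 1 /\ z \in ts.
Proof.
move=> offB le_im w1 /mem_prefwP[[k _ zB]|[k lt_ki ->]].
  by left; rewrite /assign (avoids_ts offB zB).
have lt_km := leq_trans lt_ki le_im.
by right; rewrite assign_nth // w1 // mem_nth.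
Qed.

Lemma assign_suffw e f x y w i B z :
    avoids B -> (forall k, i <= k -> w k = 1) -> z \in suffw B T i m ->
  assign ts e f x y w z = (if z == x then e else if z == y then f else 1) \/
  assign ts e f x y w z = 1 /\ z \in ts.
Proof.
move=> offB w1 /mem_suffwP[[k _ zB]|[k /andP[le_ik lt_km] ->]].
  by left; rewrite /assign (avoids_ts offB zB).
by right; rewrite assign_nth // w1 // mem_nth.
Qed.

Lemma assign_block e f x y w k B z : avoids B -> z \in B k ->
  assign ts e f x y w z = if z == x then e else if z == y then f else 1.
Proof. by move=> offB zB; rewrite /assign (avoids_ts offB zB). Qed.

Lemma assign_vals e f x y w z :
    assign ts e f x y w z = (if z == x then e else if z == y then f else 1) \/
    assign ts e f x y w z = 1 /\ z \in ts ->
  [\/ assign ts e f x y w z = e, assign ts e f x y w z = f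
    | assign ts e f x y w z = 1].
Proof.
case=> [->|[-> _]]; last by constructor 3.
by case: ifP => _; [constructor 1 | case: ifP; [constructor 2|constructor 3]].
Qed.

(** A factor e f on the left absorbs the prefix except for the value h of its last separator. The
    multiplier l is the same for all [B], so both sides of an identity can be multiplied by it; for
    i = 0 there is no separator and l itself contains h. *)
Lemma eval_prefix e f x y w i h :
    idem e -> idem f -> i <= m -> (forall k, k.+1 < i -> w k = 1) ->
    (forall k, k.+1 = i -> w k = h) ->
  exists l, forall B, avoids B ->
    l * eval (assign ts e f x y w) (prefw B T i) = e * f * h.
Proof.
move=> ee ff; case: i => [|i] le_im w1 wh.
  by exists (e * f * h) => B _; rewrite prefw0 eval_nil mulg1.
exists (e * f) => B offB; rewrite prefwS catA eval_cat mulgA eval_seq1.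
rewrite assign_nth // wh // eval_absorb_pair // => z; rewrite mem_cat.
case/orP=> [zp|zB]; apply: assign_vals; last by left; rewrite (assign_block _ _
  _ _ _ offB zB).
by apply: assign_prefw zp => //; apply: ltnW.
Qed.

Lemma eval_suffix_single e x w i s :
    idem e -> ~~ S x -> w i = s -> (forall k, i < k -> w k = 1) ->
  exists r, forall B, avoids B ->
    eval (assign ts e 1 x x w) (suffw B T i m) * r = s * e.
Proof.
move=> ee nSx ws w1; case: (ltnP i m) => [lt_im|le_mi]; last first.
  by exists (s * e) => B _; rewrite suffw_geq // eval_nil mul1g.
exists e => B offB; rewrite suffw_ltn // eval_cons assign_nth // ws -mulgA.
congr (_ * _); rewrite (@eval_single _ e x) => [|//|z].
  by case: ifP; rewrite ?mul1g.
rewrite mem_cat => /orP[zB|zq].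
  by rewrite (assign_block _ _ _ _ _ offB zB); case: eqP.
have [->|[-> zts]] := assign_suffw e 1 x x offB (w1) zq; first by case: eqP.
by case: eqP => // zx; rewrite -zx (ts_S zts) in nSx.
Qed.

Lemma content_gap_fill B B' i x :
    avoids B -> avoids B' -> agree M B B' -> i <= m -> x \in B i -> x \notin B'
      i ->
  gap_fill M.
Proof.
move=> offB offB' agM le_im xB xB' e t s ee.
(* The separators around block i receive t and s, so that the block contributes the middle e of e t
   e s e on one side and nothing on the other. *)
pose w k := if k.+1 == i then t else if k == i then s else 1.
have nSx := offB _ _ xB.
have [l defl] : exists l, forall B, avoids B ->
    l * eval (assign ts e 1 x x w) (prefw B T i) = e * 1 * t.
  apply: eval_prefix => // [||k ki]; first exact: idem1.
    move=> k lt_ki; rewrite /w (ltn_eqF lt_ki) ifF //.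
    by apply: ltn_eqF; apply: ltnW.
  by rewrite /w ki eqxx.
have [r defr] : exists r, forall B, avoids B ->
    eval (assign ts e 1 x x w) (suffw B T i m) * r = s * e.
  apply: eval_suffix_single => // [|k lt_ik].
    by rewrite /w (gtn_eqF (ltnSn i)) eqxx.
  by rewrite /w !(gtn_eqF (leqW _)) // (gtn_eqF lt_ik).
have := congr1 (fun v => l * v * r)
  (agM (assign ts e 1 x x w) (fun z => idem_assign x x w ee (idem1 M))).
rewrite /= !(blockw_split _ _ le_im) !eval_cat !mulgA defl // defl //.
rewrite -!(mulgA _ _ r) !defr // mulg1.
rewrite !(@eval_single _ e x) ?xB ?(negPf xB') ?mulg1 ?mulgA //.
  by move=> z zB; rewrite (assign_block _ _ _ _ _ offB' zB); case: eqP.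
by move=> z zB; rewrite (assign_block _ _ _ _ _ offB zB); case: eqP.
Qed.

(** With only the separator at j kept, a word records no more than whether x occurs before and after
    it. *)
Lemma eval_cut e t x B j :
    avoids B -> idem e -> ~~ S x -> j < m ->
  eval (assign ts e 1 x x (fun k => if k == j then t else 1)) (blockw B T m) =
  (if x \in prefw B T j ++ B j then e else 1) * t *
  (if x \in B j.+1 ++ suffw B T j.+1 m then e else 1).
Proof.
move=> offB ee nSx lt_jm; rewrite (blockw_split _ _ (ltnW lt_jm)) suffw_ltn //.
rewrite catA eval_cat eval_cons assign_nth // eqxx mulgA.
have nts z : z \in ts -> z == x = false.
  by move=> /ts_S; apply: contraTF => /eqP ->.
congr (_ * _ * _); apply: eval_single => // z; rewrite mem_cat.
  case/orP=> [zp|zB]; last by rewrite (assign_block _ _ _ _ _ offB zB); case: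
    eqP.
  have w1 k : k < j -> (if k == j then t else 1) = 1 by move/ltn_eqF->.
  have [->|[-> /nts->//]] := assign_prefw e 1 x x offB (ltnW lt_jm) w1 zp.
  by case: eqP.
case/orP=> [zB|zq]; first by rewrite (assign_block _ _ _ _ _ offB zB); case:
  eqP.
have w1 k : j < k -> (if k == j then t else 1) = 1 by move/gtn_eqF->.
have [->|[-> /nts->//]] := assign_suffw e 1 x x offB w1 zq.
by case: eqP.
Qed.

Lemma content_left_fill B B' j x :
    avoids B -> avoids B' -> agree M B B' -> j < m -> ~~ S x ->
    x \in prefw B T j ++ B j -> x \notin prefw B' T j ++ B' j ->
  left_fill M.
Proof.
move=> offB offB' agM lt_jm nSx xB xB' e t ee.
(* Multiplying by e on the right hides whether x occurs after the separator, so that the difference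
   before it remains. *)
have := congr1 (fun v => v * e) (agM _ (fun z => idem_assign x x
  (fun k => if k == j then t else 1) ee (idem1 M))).
rewrite /= !eval_cut // xB (negPf xB') mul1g.
by do 2![case: (_ \in _)]; rewrite -?(mulgA _ e e) ?ee ?mulg1 ?ee.
Qed.

Lemma content_right_fill B B' j x :
    avoids B -> avoids B' -> agree M B B' -> j < m -> ~~ S x ->
    x \in B j.+1 ++ suffw B T j.+1 m -> x \notin B' j.+1 ++ suffw B' T j.+1 m ->
  right_fill M.
Proof.
move=> offB offB' agM lt_jm nSx xB xB' e t ee.
have := congr1 (fun v => e * v) (agM _ (fun z => idem_assign x x
  (fun k => if k == j then t else 1) ee (idem1 M))).
rewrite /= !eval_cut // xB (negPf xB') mulg1 !mulgA.
by do 2![case: (_ \in _)]; rewrite ?mulg1 ?ee.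
Qed.

End Consequences.

(** * The order of letters in a block *)

Definition inverted (x y : nat) (b b' : word) :=
  filter (pred2 x y) b = [:: x; y] /\ filter (pred2 x y) b' = [:: y; x].

Lemma filter_pred2 (x y : nat) b1 b2 :
  uniq (b1 ++ y :: b2) -> x \in b1 ->
  filter (pred2 x y) (b1 ++ y :: b2) = [:: x; y].
Proof.
rewrite cat_uniq /= => /and3P[b1u /norP[yb1 b12] /andP[yb2 b2u]] xb1.
rewrite filter_cat /= eqxx orbT.
have -> : filter (pred2 x y) b1 = [:: x].
  rewrite -(filter_pred1_uniq b1u xb1); apply: eq_in_filter => z zb1 /=.
  by rewrite orbC; case: eqP => // zy; rewrite -zy zb1 in yb1.
have -> // : filter (pred2 x y) b2 = [::].
apply/eqP; rewrite -[_ == _]negbK -has_filter; apply/hasPn => z zb2 /=.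
apply/norP; split; last by apply: contraNneq yb2 => <-.
by apply: contraNneq b12 => zx; apply/hasP; exists z; rewrite //= zx.
Qed.

(** The first letter of b' moves to the front of b, past letters that are all inverted with it. [E]
    is abstract so that the induction can continue behind this common first letter. *)
Lemma bubble_sort (E : word -> word -> Prop) (b b' : word) :
    (forall u, E u u) -> (forall u v w, E u v -> E v w -> E u w) ->
    uniq b -> perm_eq b b' ->
    (forall x y, inverted x y b b' ->
       forall g q, E (g ++ x :: y :: q) (g ++ y :: x :: q)) ->
  E b b'.
Proof.
elim: b' b E => [|y b' IHb] b E Er Et b_uniq.
  by move=> bb' _; move/perm_nilP: bb' => ->.
move=> bb' swap; have b'_uniq : uniq (y :: b') by rewrite -(perm_uniq bb').
have /splitPr def_b : y \in b by rewrite (perm_mem bb') mem_head.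
case: def_b => b1 b2 in b_uniq bb' swap *.
have bb2' : perm_eq (b1 ++ b2) b'.
  by rewrite -(perm_cons y) (perm_trans _ bb') // -cat_rcons -cat1s catA
     perm_cat2r -cats1 perm_catC.
have yb' : y \notin b' by case/andP: b'_uniq.
apply: (Et _ (y :: b1 ++ b2)).
  have: forall x, x \in b1 ->
      forall g q, E (g ++ x :: y :: q) (g ++ y :: x :: q).
    move=> x xb1; apply: swap; split; first exact: filter_pred2.
    have xb' : x \in b' by rewrite -(perm_mem bb2') mem_cat xb1.
    rewrite /= eqxx orbT; congr (_ :: _).
    rewrite -(filter_pred1_uniq _ xb'); last by case/andP: b'_uniq.
    apply: eq_in_filter => z zb1 /=; rewrite orbC; case: eqP => // zy.
    by rewrite -zy zb1 in yb'.
  elim/last_ind: b1 b2 {b_uniq bb' swap bb2'} => [|b1 x IHb1] b2 swap_y.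
    exact: Er.
  rewrite cat_rcons; apply: (Et _ (b1 ++ y :: x :: b2)).
    by apply: swap_y; rewrite mem_rcons mem_head.
  rewrite cat_rcons; apply: IHb1 => z zb1; apply: swap_y.
  by rewrite mem_rcons inE zb1 orbT.
apply: (IHb _ (fun u v => E (y :: u) (y :: v))) => // [u v w||]; first exact:
  Et.
  by move: b_uniq; rewrite uniq_catC /= uniq_catC => /andP[].
move=> x z [fb fb'] g q.
have xb' : x \in b'.
  have: x \in [:: z; x] by rewrite !inE eqxx orbT.
  by rewrite -fb' mem_filter => /andP[].
have zb' : z \in b'.
  have: z \in [:: z; x] by rewrite mem_head.
  by rewrite -fb' mem_filter => /andP[].
have nyxz : (y == x) || (y == z) = false.
  by apply: contraNF yb' => /orP[] /eqP ->.
apply: (swap x z _ (y :: g)); split=> /=; rewrite ?nyxz //.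
by rewrite filter_cat /= nyxz -filter_cat.
Qed.

(** [undup] keeps last occurrences; reversing before and after keeps the first ones. *)
Definition ini (b : word) : word := rev (undup (rev b)).

Lemma ini_uniq b : uniq (ini b).
Proof. by rewrite rev_uniq undup_uniq. Qed.

Lemma mem_ini b : ini b =i b.
Proof. by move=> z; rewrite mem_rev mem_undup mem_rev. Qed.

Lemma eval_ini (M : monoidType) (phi : nat -> M) b :
    basic M -> (forall z, z \in b -> idem (phi z)) ->
  eval phi (ini b) = eval phi b.
Proof.
move=> bM; elim/last_ind: b => [|b x IHb] id_b //.
have {}IHb : eval phi (ini b) = eval phi b.
  by apply: IHb => z zb; apply: id_b; rewrite mem_rcons inE zb orbT.
rewrite /ini rev_rcons /= mem_rev -/(ini b) -cats1 eval_cat eval_seq1.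
case: ifP => xb; last by rewrite rev_cons -cats1 eval_cat eval_seq1 -/(ini b)
  IHb.
rewrite -/(ini b) IHb eval_absorb // => z zb.
by apply: id_b; rewrite mem_rcons inE zb orbT.
Qed.

Lemma eval_filter (M : monoidType) (phi : nat -> M) (P : pred nat) b :
    (forall z, z \in b -> ~~ P z -> phi z = 1) ->
  eval phi b = eval phi (filter P b).
Proof.
elim: b => [|x b IHb] vals //=; rewrite eval_cons IHb => [|z zb]; last first.
  by apply: vals; rewrite inE zb orbT.
case: ifPn => [_|nPx]; first by rewrite eval_cons.
by rewrite vals ?mem_head // mul1g.
Qed.

(* The number of maximal runs in the sequence K 0, ..., K (i - 1) with the
   entries None dropped, and the value of the first run. *)
Fixpoint runs (K : nat -> option bool) i : nat * option bool :=
  if i is i'.+1 then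
    let: (n, o) := runs (fun k => K k.+1) i' in
    if K 0 is Some b then if o == Some b then (n, o) else (n.+1, Some b)
    else (n, o)
  else (0, None).

Lemma runs_None K i : ((runs K i).1 == 0) = ((runs K i).2 == None).
Proof.
elim: i K => //= i IHi K; move: (IHi (fun k => K k.+1)).
case: (runs _ i) => n o /= n0; case: (K 0) => // b.
by case: ifP => //= /eqP ->.
Qed.

Section Runs.
Variable M : monoidType.
Implicit Types (e f : M) (hs : seq M) (K : nat -> option bool) (o : option
  bool).

Definition kind_val e f o : M :=
  if o is Some b then if b then e else f else 1.

Definition alt_from o e f hs : M :=
  if o is Some false then alt f e hs else alt e f hs.

Lemma alt_from_cons b o e f h hs : o != Some b -> (o == None) = nilp hs ->
  alt_from (Some b) e f (h :: hs) =
  kind_val e f (Some b) * h * alt_from o e f hs.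
Proof. by case: b; case: o => [[]|] //= _ /esym/nilP->. Qed.

Arguments alt_from : simpl never.

(** The entries of [hs] are placed behind the last term of each run and 1 elsewhere; within a run
    the repeated idempotent collapses. *)
Lemma runs_realize K i e f hs :
    idem e -> idem f -> size hs = (runs K i).1 ->
  exists w : nat -> M,
    \prod_(0 <= k < i) (kind_val e f (K k) * w k) =
    alt_from (runs K i).2 e f hs.
Proof.
move=> ee ff; elim: i K hs => [|i IHi] K hs /=.
  by move=> /size0nil ->; exists (fun=> 1); rewrite big_geq.
have := runs_None (fun k => K k.+1) i; move: (IHi (fun k => K k.+1)).
case: (runs _ i) => n o /= {}IHi n0.
case K0: (K 0) => [b|] /=; last first.
  move=> /IHi[w def_w]; exists (fun k => if k is k'.+1 then w k' else 1).
  by rewrite big_nat_recl //= K0 !mul1g.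
case: (eqVneq o (Some b)) => [ob|o'b] /= size_hs.
  case: hs size_hs => [|h hs] size_hs; first by rewrite -size_hs ob in n0.
  have [w def_w] := IHi _ size_hs.
  exists (fun k => if k is k'.+1 then w k' else 1).
  rewrite big_nat_recl //= K0 def_w mulg1 ob.
  by case: (b); rewrite /= !mulgA ?ee ?ff.
case: hs size_hs => [|h hs] //= [size_hs].
have [w def_w] := IHi _ size_hs.
exists (fun k => if k is k'.+1 then w k' else h).
rewrite big_nat_recl //= K0 def_w -(alt_from_cons _ _ _ o'b) //.
by rewrite -n0 -size_hs.
Qed.

(** Conversely, a factor is picked from the last term of each run. What lies behind a picked factor
    is merged into [hs], what precedes the first one into g. *)
Lemma runs_locate K i e f (c w : nat -> M) :
    (forall k b, k < i -> K k = Some b ->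
       exists a d, c k = a * kind_val e f (Some b) * d) ->
  exists g hs, size hs = (runs K i).1 /\
    \prod_(0 <= k < i) (c k * w k) = g * alt_from (runs K i).2 e f hs.
Proof.
elim: i K c w => [|i IHi] K c w cK.
  by exists 1, [::]; rewrite big_geq //= mul1g.
rewrite big_nat_recl //=.
have := runs_None (fun k => K k.+1) i.
have := IHi (fun k => K k.+1) (fun k => c k.+1) (fun k => w k.+1) (fun k b => cK
  k.+1 b).
case: (runs _ i) => n o /= [g [hs [size_hs ->]]] n0.
case K0: (K 0) => [b|] /=; last first.
  by exists (c 0 * w 0 * g), hs; rewrite mulgA.
case: (eqVneq o (Some b)) => [ob|o'b] /=.
  by exists (c 0 * w 0 * g), hs; rewrite mulgA.
have [a [d ->]] := cK 0 b isT K0.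
exists a, (d * w 0 * g :: hs); split; first by rewrite /= size_hs.
by rewrite (alt_from_cons _ _ _ o'b) ?mulgA // -n0 -size_hs.
Qed.

Lemma alt_mulr e f hs g :
  hs != [::] -> exists2 hs', size hs' = size hs & alt e f hs * g = alt e f hs'.
Proof.
elim: hs e f => // h [|h' hs] IHhs e f _.
  by exists [:: h * g]; rewrite //= !mulg1 mulgA.
have [hs' size_hs' def_hs'] := IHhs f e isT.
exists (h :: hs'); first by rewrite /= size_hs'.
by rewrite -[alt e f (h :: hs')]/(e * h * alt f e hs') -def_hs' /= !mulgA.
Qed.

(** The extra factor g is merged into h_n. For n = 0 there is no h_n, but sigma_0 makes idempotents
    commute. *)
Lemma sigma_mulr n e f hs g :
    sigma n M -> idem e -> idem f -> size hs = n ->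
  alt e f hs * g * e * f = alt e f hs * g * f * e.
Proof.
move=> sM ee ff size_hs; have [hs0|hsn0] := eqVneq hs [::].
  have /= := sM e f hs ee ff size_hs; rewrite hs0 /= !mul1g => ef.
  by rewrite -!mulgA ef.
have [hs' size_hs' ->] := alt_mulr e f g hsn0.
by apply: sM; rewrite ?size_hs'.
Qed.

Lemma sigma_from n o e f hs g :
    sigma n M -> idem e -> idem f -> size hs = n ->
  alt_from o e f hs * g * e * f = alt_from o e f hs * g * f * e.
Proof.
move=> sM ee ff size_hs; rewrite /alt_from; case: o => [[]|]; do ?exact:
  (sigma_mulr g sM).
by rewrite -(sigma_mulr g sM).
Qed.

End Runs.

Definition kind (x y : nat) (B : nat -> word) k : option bool :=
  if x \in B k then Some true else if y \in B k then Some false else None.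

Section Order.
Variables (S : pred nat) (ts : seq nat).
Hypotheses (ts_uniq : uniq ts) (ts_S : forall z, z \in ts -> S z).
Local Notation T := (nth 0 ts).
Local Notation m := (size ts).

Section Swap.
Variables (M : monoidType) (bM : basic M).
Implicit Types (B : nat -> word) (i : nat).

Lemma eval_inverted (e f : M) x y w B k :
    avoids S B -> x != y -> filter (pred2 x y) (B k) = [:: x; y] ->
  eval (assign ts e f x y w) (B k) = e * f.
Proof.
move=> offB nxy fB; rewrite (eval_filter (P := pred2 x y)) => [|z zB]; last
  first.
  rewrite (assign_block ts_S _ _ _ _ _ offB zB) negb_or.
  by case/andP=> /negPf-> /negPf->.
have /(avoids_ts ts_S offB) xts : x \in B k.
  by have := mem_head x [:: y]; rewrite -fB mem_filter => /andP[].
have /(avoids_ts ts_S offB) yts : y \in B k.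
  by have := mem_last x [:: y]; rewrite -fB mem_filter => /andP[].
rewrite fB !eval_cons eval_nil mulg1 /assign xts yts !eqxx.
by rewrite eq_sym (negPf nxy).
Qed.

Lemma eval_block_pair (e f : M) x y w B i :
    avoids S B -> idem e -> idem f -> x != y -> i <= m ->
    (forall k, i <= k -> w k = 1) ->
    filter (pred2 x y) (B i) = [:: x; y] ->
  eval (assign ts e f x y w) (B i ++ suffw B T i m) = e * f.
Proof.
move=> offB ee ff nxy le_im w1 fB; rewrite eval_cat (eval_inverted _ _ _ offB)
  //.
apply: eval_absorb_pair => // z zq.
exact/assign_vals/(assign_suffw ts_uniq ts_S _ _ _ _ offB w1 zq).
Qed.

Lemma assign_swap (e f : M) x y w : x != y ->
  assign ts e f x y w =1 assign ts f e y x w.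
Proof.
move=> nxy z; rewrite /assign; case: ifP => // _.
by have [->|//] := eqVneq z x; rewrite (negPf nxy).
Qed.

Section Inversion.
Variables (B B' : nat -> word) (i x y : nat).
Hypotheses (offB : avoids S B) (offB' : avoids S B') (agM : agree S ts M B B').
Hypotheses (le_im : i <= m) (nxy : x != y) (inv_xy : inverted x y (B i) (B' i)).

(** The separators from position i on are sent to 1, so block i evaluates to e f or f e and absorbs
    all that follows. *)
Lemma eval_inversion (e f : M) w :
    idem e -> idem f -> (forall k, i <= k -> w k = 1) ->
  eval (assign ts e f x y w) (prefw B T i) * e * f =
  eval (assign ts e f x y w) (prefw B' T i) * f * e.
Proof.
move=> ee ff w1; case: inv_xy => inv_B inv_B'.
have := agM (fun z => idem_assign ts_S x y w ee ff).
rewrite !(blockw_split _ _ le_im) !(eval_cat _ (prefw _ _ _)) -!mulgA.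
rewrite eval_block_pair // => ->; congr (_ * _).
rewrite (eq_in_eval (psi := assign ts f e y x w)) => [|z _].
  apply: eval_block_pair; rewrite // 1?eq_sym // -inv_B'.
  by apply: eq_filter => z /=; rewrite orbC.
exact: assign_swap.
Qed.

Lemma inversion_sigma_inf : sigma_inf M.
Proof.
(* Only the separator just before block i keeps a value, h; [eval_prefix] then turns both prefixes
   into e f h. *)
move=> e f h ee ff; pose w k := if k.+1 == i then h else 1.
have [l defl] : exists l, forall B, avoids S B ->
    l * eval (assign ts e f x y w) (prefw B T i) = e * f * h.
  apply: eval_prefix => // k; first by move/ltn_eqF=> lt_ki; rewrite /w lt_ki.
  by move=> ki; rewrite /w ki eqxx.
have w1 k : i <= k -> w k = 1 by move=> le_ik; rewrite /w gtn_eqF.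
have := congr1 (fun v => l * v) (eval_inversion ee ff w1).
by rewrite /= !mulgA !defl.
Qed.

Hypothesis B_uniq : forall k, k < i -> uniq (B k) && uniq (B' k).
Hypothesis eqBB' : forall k, k < i -> B k =i B' k.
Hypothesis apart : forall k, k < i -> ~~ ((x \in B k) && (y \in B k)).

Lemma eval_kind (e f : M) w B1 k :
    avoids S B1 -> uniq (B1 k) -> ~~ ((x \in B1 k) && (y \in B1 k)) ->
  eval (assign ts e f x y w) (B1 k) = kind_val e f (kind x y B1 k).
Proof.
move=> offB1 B1u; rewrite /kind; have val z := @assign_block _ _ ts_S M e f x y
  w k B1 z offB1.
case: ifP => xB /=.
  move=> yB; rewrite (eval_filter (P := pred1 x)) => [|z zB /= /negPf nzx].
    by rewrite filter_pred1_uniq // eval_seq1 val // eqxx.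
  by rewrite val // nzx; case: eqP => // zy; rewrite -zy zB in yB.
case: ifP => yB _ /=.
  rewrite (eval_filter (P := pred1 y)) => [|z zB /= /negPf nzy].
    by rewrite filter_pred1_uniq // eval_seq1 val // eq_sym (negPf nxy) eqxx.
  by rewrite val // nzy; case: eqP => // zx; rewrite -zx zB in xB.
rewrite (eval_filter (P := pred0)) => [|z zB _].
  by rewrite filter_pred0 eval_nil.
rewrite val //; case: eqP => [zx|_]; first by rewrite -zx zB in xB.
by case: eqP => // zy; rewrite -zy zB in yB.
Qed.

Lemma eval_prefw (phi : nat -> M) B1 j :
  eval phi (prefw B1 T j) = \prod_(0 <= k < j) (eval phi (B1 k) * phi (T k)).
Proof.
elim: j => [|j IHj]; first by rewrite prefw0 eval_nil big_geq.
by rewrite prefwS big_nat_recr //= !eval_cat eval_seq1 IHj.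
Qed.

Lemma inversion_sigma : sigma (runs (kind x y B) i).1 M.
Proof.
move=> e0 f0 hs ee0 ff0 size_hs.
set o := (runs (kind x y B) i).2.
(* If the first run is one of y, then y receives e0, so that the alternation starts with e0 in
   either case. *)
pose e := if o is Some false then f0 else e0.
pose f := if o is Some false then e0 else f0.
have [ee ff] : idem e /\ idem f by rewrite /e /f; case: (o) => [[]|].
have [w def_w] := runs_realize ee ff size_hs.
pose w' k := if k < i then w k else 1.
have eval_w B1 : avoids S B1 -> (forall k, k < i -> uniq (B1 k)) ->
    (forall k, k < i -> B k =i B1 k) ->
    eval (assign ts e f x y w') (prefw B1 T i) = alt_from o e f hs.
  move=> offB1 B1u eqB; rewrite eval_prefw -def_w; apply: eq_big_nat => k lt_ki.
  rewrite /= in lt_ki; rewrite assign_nth ?(leq_trans lt_ki) // /w' lt_ki.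
  rewrite eval_kind ?B1u // -?eqB ?apart //.
  by rewrite /kind -!eqB.
have := eval_inversion ee ff (w := w').
rewrite !eval_w // => [|k /B_uniq/andP[]|k /B_uniq/andP[]] // ef.
have {}ef: alt_from o e f hs * e * f = alt_from o e f hs * f * e.
  by apply: ef => k le_ik; rewrite /w' ltnNge le_ik.
move: ef; rewrite /alt_from /e /f; case: (o) => [[]|] //.
Qed.

End Inversion.

Lemma prefw_split B k i : k < i -> exists q, prefw B T i = prefw B T k ++ B k ++
  q.
Proof.
elim: i => // i IHi; rewrite ltnS leq_eqVlt prefwS => /predU1P[->|/IHi[q ->]].
  by exists [:: T i].
by exists (q ++ B i ++ [:: T i]); rewrite !catA.
Qed.

(** Block k absorbs x y on its right, and so supplies the left factor e f of [sigma_inf]. *)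
Lemma swap_inf (phi : nat -> M) B i k x y (g : M) :
    sigma_inf M -> (forall z, ~~ S z -> idem (phi z)) -> avoids S B ->
    k < i -> x \in B k -> y \in B k ->
  eval phi (prefw B T i) * g * phi x * phi y =
  eval phi (prefw B T i) * g * phi y * phi x.
Proof.
move=> sM id_phi offB /(prefw_split B)[q ->] xB yB.
have id_B z : z \in B k -> idem (phi z) by move=> /offB/id_phi.
have absorb : eval phi (B k) = eval phi (B k) * phi x * phi y.
  by rewrite eval_absorb // eval_absorb.
rewrite !eval_cat absorb -!mulgA; congr (_ * (_ * _)); rewrite !mulgA.
by rewrite -!(mulgA _ (eval phi q) g); exact: sM (id_B x xB) (id_B y yB).
Qed.

Lemma swap_runs (phi : nat -> M) B i x y (g : M) :
    sigma (runs (kind x y B) i).1 M -> idem (phi x) -> idem (phi y) ->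
  eval phi (prefw B T i) * g * phi x * phi y =
  eval phi (prefw B T i) * g * phi y * phi x.
Proof.
move=> sM idx idy.
have [k b _|g0 [hs [size_hs def_p]]] := @runs_locate M (kind x y B) i (phi x)
  (phi y)
    (fun k => eval phi (B k)) (fun k => phi (T k)).
  rewrite /kind; case: ifP => [/splitPr[w1 w2]|_].
    by case=> <-; exists (eval phi w1), (eval phi w2); rewrite !evalE.
  case: ifP => // /splitPr[w1 w2] [<-].
  by exists (eval phi w1), (eval phi w2); rewrite !evalE.
rewrite eval_prefw def_p -!(mulgA g0); congr (_ * _).
exact: sigma_from size_hs.
Qed.

End Swap.

Variables (V : monoid_class) (N : monoidType).
Hypotheses (bV : forall M, V M -> basic M) (bN : basic N).

Lemma agree_order_uniq B B' :
    avoids S B -> avoids S B' -> (forall k, uniq (B k)) -> (forall k, uniq (B'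
      k)) ->
    (forall k, k <= m -> B k =i B' k) ->
    ((forall M, V M -> sigma_inf M) -> sigma_inf N) ->
    (forall n, (forall M, V M -> sigma n M) -> sigma n N) ->
    (forall M, V M -> agree S ts M B B') ->
  agree S ts N B B'.
Proof.
move=> offB offB' uB uB' eqB Ninf Nsig agV phi id_phi.
apply: eval_hybrid => i le_im.
move: (suffw B' T i m) => q0.
pose E u v := forall q, eval phi (prefw B T i ++ u ++ q) = eval phi (prefw B T i
  ++ v ++ q).
suff: E (B i) (B' i) by apply.
apply: bubble_sort => // [u v w Euv Evw q||x y inv_xy g q1 q2].
- by rewrite Euv.
- by apply: uniq_perm => //; apply: eqB.
have nxy : x != y.
  have := filter_uniq (pred2 x y) (uB i); case: inv_xy => -> _ /=.
  by rewrite mem_seq1 andbT.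
have [xB yB] : x \in B i /\ y \in B i.
  have [fB _] := inv_xy; have := mem_head x [:: y]; have := mem_last x [:: y].
  by rewrite -fB !mem_filter => /andP[_ yB] /andP[].
have sinf : sigma_inf N.
  apply: Ninf => M VM.
  exact: (inversion_sigma_inf (bV VM) offB offB' (agV _ VM) le_im nxy inv_xy).
suff swap (h : N) : eval phi (prefw B T i) * h * phi x * phi y =
                    eval phi (prefw B T i) * h * phi y * phi x.
  by rewrite -!catA /= !(eval_cat, eval_cons) !mulgA swap.
(* If x and y share an earlier block, [sigma_inf] allows the swap. Otherwise sigma_n does, where n
   counts the runs of x and y in the earlier blocks; the inversion forces this sigma_n in [V]. *)
have [[k lt_ki /andP[xBk yBk]]|apart] :=
    pselect (exists2 k, k < i & (x \in B k) && (y \in B k)).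
  exact: (swap_inf bN _ sinf id_phi offB lt_ki).
apply: swap_runs; try by apply/id_phi/offB; eassumption.
apply: Nsig => M VM.
apply: (inversion_sigma (bV VM) offB offB' (agV _ VM) le_im nxy inv_xy).
- by move=> k _; rewrite uB uB'.
- by move=> k lt_ki; apply: eqB; rewrite (leq_trans (ltnW lt_ki)).
by move=> k lt_ki; apply/negP => xyB; apply: apart; exists k.
Qed.

Lemma agree_order B B' :
    avoids S B -> avoids S B' -> (forall k, k <= m -> B k =i B' k) ->
    ((forall M, V M -> sigma_inf M) -> sigma_inf N) ->
    (forall n, (forall M, V M -> sigma n M) -> sigma n N) ->
    (forall M, V M -> agree S ts M B B') ->
  agree S ts N B B'.
Proof.
move=> offB offB' eqB Ninf Nsig agV.
have avoids_ini B1 : avoids S B1 -> avoids S (ini \o B1).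
  by move=> offB1 k z; rewrite mem_ini; apply: offB1.
have eval_inis (M : monoidType) (phi : nat -> M) B1 : basic M -> avoids S B1 ->
    (forall z, ~~ S z -> idem (phi z)) ->
    eval phi (blockw (ini \o B1) T m) = eval phi (blockw B1 T m).
  move=> bM offB1 id_phi; apply: eval_hybrid => i _.
  by rewrite !eval_cat eval_ini // => z /offB1/id_phi.
move=> phi id_phi; rewrite -(eval_inis N) // -(eval_inis N phi B') //.
apply: agree_order_uniq => //; try exact: avoids_ini.
- by move=> k; apply: ini_uniq.
- by move=> k; apply: ini_uniq.
- by move=> k le_km z; rewrite !mem_ini eqB.
by move=> M VM psi id_psi; rewrite !eval_inis ?agV //; apply: bV.
Qed.

End Order.

(** * The contents of the blocks *)

Section Saturation.
Variables (S : pred nat) (ts : seq nat).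
Hypotheses (ts_uniq : uniq ts) (ts_S : forall z, z \in ts -> S z).
Local Notation T := (nth 0 ts).
Local Notation m := (size ts).

Section Saturate.
Variables (lend rend : bool) (X : word).
Hypothesis offX : forall x, x \in X -> ~~ S x.
Implicit Type B : nat -> word.

(* lend and rend record that the left, respectively right, fill law holds, so
   that an occurrence of x on that side of the block is not required. *)
Definition fillable B i x :=
  ((x \in prefw B T i ++ B i) || lend) && ((x \in B i ++ suffw B T i m) ||
    rend).

(** Letters are appended even when already present, since repetitions are absorbed and [agree_order]
    compares contents only. *)
Definition saturate B i : word := B i ++ filter (fillable B i) X.

Lemma avoids_saturate B : avoids S B -> avoids S (saturate B).
Proof. by move=> offB k z; rewrite mem_cat mem_filter => /orP[/offB|/andP[_
  /offX]]. Qed.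

Lemma saturateE B i x :
    i <= m -> avoids S B -> (forall z, z \in blockw B T m -> ~~ S z -> z \in X)
      ->
  (x \in saturate B i) = (x \in X) && fillable B i x.
Proof.
move=> le_im offB wdX; rewrite mem_cat mem_filter andbC.
have [xB|] //= := boolP (x \in B i).
rewrite wdX ?(offB _ _ xB) //; last by rewrite (blockw_split _ _ le_im) !mem_cat
  xB orbT.
by rewrite /fillable !mem_cat xB !orbT.
Qed.

Lemma mem_eval (M : monoidType) (phi : nat -> M) x u :
  x \in u -> exists a d, eval phi u = a * phi x * d.
Proof.
by case/splitPr=> u1 u2; exists (eval phi u1), (eval phi u2); rewrite !evalE.
Qed.

(** [gap_fill] inserts a missing letter between an earlier and a later occurrence; [right_fill]
    dispenses with the later one, [left_fill] with the earlier one. *)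
Lemma eval_saturate (M : monoidType) (phi : nat -> M) B :
    basic M -> gap_fill M -> (lend -> left_fill M) -> (rend -> right_fill M) ->
    (forall z, ~~ S z -> idem (phi z)) -> avoids S B ->
    {subset X <= blockw B T m} ->
  eval phi (blockw B T m) = eval phi (blockw (saturate B) T m).
Proof.
move=> bM c1 c2' c2 id_phi offB XB; apply: eval_hybrid => i le_im.
set q := suffw _ _ _ _; rewrite /saturate -!catA !(catA (prefw B T i)).
rewrite [RHS]eval_cat [LHS]eval_cat.
have fillX x : x \in filter (fillable B i) X -> fillable B i x && (x \in X).
  by rewrite mem_filter.
elim: (filter _ X) fillX => [|x A IHA] fillX; first by [].
rewrite {}IHA => [|y yA]; last by apply: fillX; rewrite inE yA orbT.
have /andP[fill_x xX] := fillX x (mem_head _ _).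
have xq : x \in suffw B T i m -> x \in q.
  move=> /mem_suffwP[[k le_ikm xB]|[k lt_km def_x]].
    by apply: (mem_suffw _ le_ikm); rewrite mem_cat xB.
  have := offX xX; rewrite def_x ts_S // mem_nth //.
  by case/andP: lt_km.
have ee : idem (phi x) := id_phi x (offX xX).
have := XB _ xX; rewrite (blockw_split _ _ le_im) catA mem_cat.
rewrite /= eval_cons (eval_cat _ (prefw _ _ _)) !(eval_cat _ A) !mulgA.
have [xB _|xB] := boolP (x \in B i).
  by rewrite -(mulgA _ _ (phi x)) eval_absorb // => z /offB/id_phi.
rewrite mem_cat (negPf xB) orbF => xpq.
have: (x \in prefw B T i) || lend && (x \in q).
  move: fill_x xpq; rewrite /fillable !mem_cat (negPf xB) orbF.
  by case: (x \in prefw _ _ _) => //= /andP[-> _] /xq.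
case/orP=> [xp|/andP[lT xq']]; last first.
  have [a [d ->]] := mem_eval phi xq'.
  have := c2' lT _ (eval phi A * a) ee; rewrite !mulgA => xtx'.
  by rewrite -!mulgA; congr (_ * (_ * _)); rewrite !mulgA xtx'.
have: rend || (x \in q).
  move: fill_x; rewrite /fillable !mem_cat (negPf xB) /= => /andP[_].
  by case/orP=> [/xq->|->] //; rewrite orbT.
have [a [d ->]] := mem_eval phi xp; case/orP=> [rT|xq'].
  have := c2 rT _ (d * eval phi (B i)) ee; rewrite !mulgA => xtx.
  by rewrite -!mulgA; congr (_ * _); rewrite !mulgA xtx.
have [a' [d' ->]] := mem_eval phi xq'.
have := c1 _ (d * eval phi (B i)) (eval phi A * a') ee; rewrite !mulgA => xtxsx.
by rewrite -!mulgA; congr (_ * _); rewrite !mulgA xtxsx.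
Qed.

End Saturate.

Variables (V : monoid_class) (N : monoidType).
Hypotheses (bV : forall M, V M -> basic M) (bN : basic N).

Lemma agree_blocks B B' :
    avoids S B -> avoids S B' -> blockw B T m =i blockw B' T m ->
    ((forall M, V M -> gap_fill M) -> gap_fill N) ->
    ((forall M, V M -> right_fill M) -> right_fill N) ->
    ((forall M, V M -> left_fill M) -> left_fill N) ->
    ((forall M, V M -> sigma_inf M) -> sigma_inf N) ->
    (forall n, (forall M, V M -> sigma n M) -> sigma n N) ->
    (forall M, V M -> agree S ts M B B') ->
  agree S ts N B B'.
Proof.
move=> offB offB' eqBB' Nc1 Nc2 Nc2' Ninf Nsig agV.
have agV' M (VM : V M) : agree S ts M B' B by apply/agree_sym/agV.
(* If [gap_fill] fails somewhere in [V], corresponding blocks must have equal contents, and only the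
   order is left to treat. *)
have [c1|not_c1] := pselect (forall M, V M -> gap_fill M); last first.
  apply: (agree_order ts_uniq ts_S bV) => // k le_km x; apply/idP/idP => xB.
    apply: contra_notT not_c1 => xB' M VM.
    exact: (content_gap_fill ts_uniq ts_S (bV VM) offB offB' (agV _ VM) le_km xB
      xB').
  apply: contra_notT not_c1 => xB' M VM.
  exact: (content_gap_fill ts_uniq ts_S (bV VM) offB' offB (agV' _ VM) le_km xB
    xB').
(* Otherwise both words are saturated by the fill laws valid in [V]. A one-sided law that fails in
   [V] forces the corresponding prefixes or suffixes to have the same letters off [S], so the
   saturated blocks have equal contents. *)
pose lend := `[< forall M, V M -> left_fill M >].
pose rend := `[< forall M, V M -> right_fill M >].
pose X := [seq x <- blockw B T m | ~~ S x].
have offX x : x \in X -> ~~ S x by rewrite mem_filter => /andP[].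
have Nlend : lend -> left_fill N by move=> /asboolP/Nc2'.
have Nrend : rend -> right_fill N by move=> /asboolP/Nc2.
have Vlend M : V M -> lend -> left_fill M by move=> VM /asboolP; apply.
have Vrend M : V M -> rend -> right_fill M by move=> VM /asboolP; apply.
have XB : {subset X <= blockw B T m} by move=> x; rewrite mem_filter => /andP[].
have XB' : {subset X <= blockw B' T m} by move=> x /XB; rewrite eqBB'.
have prefix_le B1 B2 i x : avoids S B1 -> avoids S B2 ->
    (forall M, V M -> agree S ts M B1 B2) -> i <= m -> ~~ lend -> ~~ S x ->
    x \in blockw B2 T m -> x \in prefw B1 T i ++ B1 i -> x \in prefw B2 T i ++
      B2 i.
  move=> off1 off2 ag12; rewrite leq_eqVlt => /predU1P[->//|lt_im] nl nSx _ xB1.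
  apply: contraNT nl => xB2; apply/asboolP => M VM.
  exact: (content_left_fill ts_uniq ts_S off1 off2 (ag12 _ VM) lt_im nSx xB1
    xB2).
have suffix_le B1 B2 i x : avoids S B1 -> avoids S B2 ->
    (forall M, V M -> agree S ts M B1 B2) -> i <= m -> ~~ rend -> ~~ S x ->
    x \in blockw B2 T m ->
    x \in B1 i ++ suffw B1 T i m -> x \in B2 i ++ suffw B2 T i m.
  move=> off1 off2 ag12; case: i => [|i] lt_im nr nSx.
    by rewrite (blockw_split _ _ (leq0n m)) prefw0.
  move=> _ xB1; apply: contraNT nr => xB2; apply/asboolP => M VM.
  exact: (content_right_fill ts_uniq ts_S off1 off2 (ag12 _ VM) lt_im nSx xB1
    xB2).
move=> phi id_phi; rewrite (eval_saturate offX bN (Nc1 c1) Nlend Nrend) //.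
rewrite [RHS](eval_saturate offX bN (Nc1 c1) Nlend Nrend) //.
apply: (agree_order ts_uniq ts_S bV bN) => //; try exact: avoids_saturate.
  move=> i le_im x.
  rewrite !saturateE // => [|z zB nSz|z zB nSz]; last 2 first.
  - by rewrite mem_filter nSz eqBB'.
  - by rewrite mem_filter nSz.
  have [xX|//] := boolP (x \in X).
  have nSx := offX x xX; have [xB xB'] := (XB x xX, XB' x xX).
  rewrite /fillable /=; congr (_ && _); apply: orb_id2r => nend; apply/idP/idP.
  - exact: prefix_le.
  - exact: prefix_le.
  - exact: suffix_le.
  - exact: suffix_le.
move=> M VM psi id_psi.
rewrite -!(eval_saturate offX (bV VM) (c1 _ VM) (Vlend _ VM) (Vrend _ VM)) //.
exact: agV.
Qed.

End Saturation.

(** * The separating identities *)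

Definition id_triv : identity := ([:: 0], [::])%N.
Definition id_idem : identity := ([:: 0], [:: 0; 0])%N.
Definition id_comm : identity := ([:: 0; 1], [:: 1; 0])%N.
Definition id_gap_fill : identity :=
  ([:: 0; 0; 1; 0; 0; 2; 0; 0], [:: 0; 0; 1; 2; 0; 0])%N.
Definition id_right_fill : identity := ([:: 0; 0; 1; 0; 0], [:: 0; 0; 1])%N.
Definition id_left_fill : identity := ([:: 0; 0; 1; 0; 0], [:: 1; 0; 0])%N.

(** The word form of [alt], with squares for idempotents and with h_1, h_2, ... named k, k + 1,
    ... *)
Fixpoint alt_word (x y k n : nat) : word :=
  if n is n'.+1 then [:: x; x; k] ++ alt_word y x k.+1 n' else [::].

Definition id_sigma n : identity :=
  (alt_word 0 1 2 n ++ [:: 0; 0; 1; 1], alt_word 0 1 2 n ++ [:: 1; 1; 0; 0])%N.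

Definition collapsing : seq identity :=
  [:: id_triv; id_idem; id_comm; id_gap_fill; id_right_fill; id_left_fill].

Definition separating (e : identity) : Prop :=
  [\/ e \in collapsing, exists n, e = id_sigma n | e = sigma_infty].

Lemma eval_altw (M : monoidType) (phi : nat -> M) x y k n :
  eval phi (alt_word x y k n) =
  alt (phi x * phi x) (phi y * phi y) [seq phi i | i <- iota k n].
Proof.
elim: n x y k => [|n IHn] x y k //=; first exact: eval_nil.
by rewrite !eval_cons IHn !mulgA.
Qed.

Section Translate.
Variable M : monoidType.
Hypothesis bM : basic M.

Lemma satisfies_gap_fill : satisfies M id_gap_fill <-> gap_fill M.
Proof.
split=> [sM e t s ee|c1 phi]; last first.
  have := c1 _ (phi 1%N) (phi 2) (idem_sq bM (phi 0)).
  by rewrite /id_gap_fill !evalE.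
by have := sM (nth 1 [:: e; t; s]); rewrite /id_gap_fill !evalE /= !ee -!(mulgA
  _ e e) !ee.
Qed.

Lemma satisfies_right_fill : satisfies M id_right_fill <-> right_fill M.
Proof.
split=> [sM e t ee|c2 phi]; last first.
  by have := c2 _ (phi 1%N) (idem_sq bM (phi 0)); rewrite /id_right_fill !evalE.
by have := sM (nth 1 [:: e; t]); rewrite /id_right_fill !evalE /= !ee -!(mulgA _
  e e) !ee.
Qed.

Lemma satisfies_left_fill : satisfies M id_left_fill <-> left_fill M.
Proof.
split=> [sM e t ee|c2 phi]; last first.
  by have := c2 _ (phi 1%N) (idem_sq bM (phi 0)); rewrite /id_left_fill !evalE.
by have := sM (nth 1 [:: e; t]); rewrite /id_left_fill !evalE /= !ee -!(mulgA _
  e e) !ee.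
Qed.

Lemma satisfies_sigma_inf : satisfies M sigma_infty <-> sigma_inf M.
Proof.
split=> [sM e f h ee ff|c2 phi]; last first.
  have := c2 _ _ (phi 2) (idem_sq bM (phi 0)) (idem_sq bM (phi 1%N)).
  by rewrite /sigma_infty !evalE.
have := sM (nth 1 [:: e; f; h]); rewrite /sigma_infty !evalE /=.
by rewrite !ee -!(mulgA _ e e) -!(mulgA _ f f) !ee !ff.
Qed.

Lemma satisfies_sigma n : satisfies M (id_sigma n) <-> sigma n M.
Proof.
split=> [sM e f hs ee ff size_hs|sM phi]; last first.
  have := sM _ _ [seq phi i | i <- iota 2 n] (idem_sq bM (phi 0)) (idem_sq bM
    (phi 1%N)).
  by rewrite size_map size_iota /= !evalE !eval_altw; apply.
have := sM (nth 1 [:: e, f & hs]); rewrite /id_sigma !eval_cat !eval_altw.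
have -> : [seq nth 1 [:: e, f & hs] i | i <- iota 2 n] = hs.
  rewrite -[2]addn0 iotaDl -map_comp -[RHS](mkseq_nth 1) size_hs.
  by apply: eq_map.
by rewrite !evalE /= ee ff -!(mulgA _ e e) -!(mulgA _ f f) !ee !ff.
Qed.

End Translate.

(** * Identities determined by the separating ones *)

Section Determination.
Variables (V : monoid_class) (N : monoidType).
Hypotheses (bV : forall M, V M -> basic M) (bN : basic N).
Hypothesis sepN :
  forall e, separating e -> (forall M, V M -> satisfies M e) -> satisfies N e.

Lemma agree_blocks_separating (S : pred nat) ts B B' :
    uniq ts -> (forall z, z \in ts -> S z) ->
    avoids S B -> avoids S B' ->
    blockw B (nth 0 ts) (size ts) =i blockw B' (nth 0 ts) (size ts) ->
    (forall M, V M -> agree S ts M B B') ->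
  agree S ts N B B'.
Proof.
move=> ts_uniq ts_S offB offB' eqB agV.
have transfer (P : monoid_class) e : separating e ->
    (forall M, basic M -> satisfies M e <-> P M) -> (forall M, V M -> P M) -> P
      N.
  by move=> sep_e eP VP; apply/eP/sepN => // M VM; apply/eP; [apply: bV | apply:
    VP].
apply: (agree_blocks ts_uniq ts_S bV bN) => //.
- by apply: (transfer _ id_gap_fill) satisfies_gap_fill; constructor 1.
- by apply: (transfer _ id_right_fill) satisfies_right_fill; constructor 1.
- by apply: (transfer _ id_left_fill) satisfies_left_fill; constructor 1.
- by apply: (transfer _ sigma_infty) satisfies_sigma_inf; constructor 3.
move=> n; apply: (transfer _ (id_sigma n)) => [|M bM]; last exact:
  satisfies_sigma.
by constructor 2; exists n.
Qed.

Lemma uniq_once (u : word) : uniq [seq x <- u | count_mem x u == 1%N].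
Proof.
apply: count_mem_uniq => x; rewrite count_filter mem_filter.
have [x1|xn1] /= := eqVneq (count_mem x u) 1%N; last first.
  rewrite (eq_count (a2 := pred0)) ?count_pred0 // => z /=.
  by case: eqP => //= ->; apply: negPf.
rewrite (eq_count (a2 := pred1 x)) => [|z /=].
  by rewrite -has_pred1 has_count x1.
by case: eqP => // ->; rewrite x1.
Qed.

(** Both words are cut at the letters occurring once; all others occur at least twice on each side,
    so idempotent values suffice for them. *)
Lemma determine_once (u v : word) :
    u =i v -> (forall x, (count_mem x u == 1%N) = (count_mem x v == 1%N)) ->
    [seq x <- u | count_mem x u == 1%N] = [seq x <- v | count_mem x u == 1%N] ->
    (forall M, V M -> satisfies M (u, v)) ->
  satisfies N (u, v).
Proof.
move=> eq_uv once_uv eq_ts Vuv phi /=.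
pose S := [pred x | count_mem x u == 1%N]; pose ts := filter S u.
have ts_S z : z \in ts -> S z by rewrite mem_filter => /andP[].
have ts_uniq : uniq ts := uniq_once u.
have [B def_u Bu] := block_decomposition S u; have [B' def_v Bv] :=
  block_decomposition S v.
rewrite -/ts in def_u; rewrite -[filter S v]eq_ts -/ts in def_v.
have offB : avoids S B by move=> k z /Bu/andP[].
have offB' : avoids S B' by move=> k z /Bv/andP[].
rewrite (eval_square_off bN (S := S)) => [|z zu nSz]; last first.
  by rewrite ltn_neqAle eq_sym nSz -has_count has_pred1.
rewrite [RHS](eval_square_off bN (S := S)) => [|z zv nSz]; last first.
  by rewrite ltn_neqAle eq_sym -once_uv nSz -has_count has_pred1.
have: agree S ts N B B'.
  apply: agree_blocks_separating => //; first by rewrite -def_u -def_v.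
  by move=> M VM psi _; rewrite -def_u -def_v; apply: Vuv.
rewrite /agree -def_u -def_v; apply=> z; exact: idem_square_off.
Qed.

Lemma eval_count (M : monoidType) (phi : nat -> M) x u :
    basic M -> (forall z, z != x -> phi z = 1) -> 1 < count_mem x u ->
  eval phi u = phi x * phi x.
Proof.
move=> bM phi1; rewrite (eval_filter (P := pred1 x)) => [|z _ /= /phi1//].
rewrite -size_filter; have /all_pred1P-> := filter_all (pred1 x) u.
rewrite size_nseq; case: (size _) => [|[|n]] // _.
elim: n => [|n IHn]; first by rewrite !evalE.
by rewrite eval_cons IHn mulgA basic_cube.
Qed.

(** Sending x to a^2 and all other letters to 1 gives a^2 = 1, and then a^3 = a^2 gives a = 1. *)
Lemma content_triv (M : monoidType) u v x :
  basic M -> satisfies M (u, v) -> x \in u -> x \notin v -> satisfies M id_triv.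
Proof.
move=> bM uv xu xv phi; have := uv (fun z => if z == x then phi 0 * phi 0 else
  1).
rewrite /id_triv !evalE.
rewrite !(@eval_single _ _ (phi 0 * phi 0) x) ?xu ?(negPf xv) //; try exact:
  idem_sq.
by move=> sq1; have := basic_cube bM (phi 0); rewrite !sq1 mul1g.
Qed.

Lemma once_idem (M : monoidType) u v x :
    basic M -> satisfies M (u, v) -> count_mem x u = 1%N -> 1 < count_mem x v ->
  satisfies M id_idem.
Proof.
move=> bM uv xu xv phi; have := uv (fun z => if z == x then phi 0 else 1).
rewrite /id_idem !evalE /= [RHS](eval_count (x := x)) //; last by move=> z
  /negPf->.
rewrite eqxx => <-; rewrite (eval_filter (P := pred1 x)) => [|z _ /=
  /negPf->//].
have /all_pred1P-> := filter_all (pred1 x) u.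
by rewrite size_filter xu !evalE eqxx.
Qed.

Lemma eval_perm (M : monoidType) (phi : nat -> M) u v :
  satisfies M id_comm -> perm_eq u v -> eval phi u = eval phi v.
Proof.
move=> comM; pose P w := eval phi u = eval phi w.
move=> /(catCA_perm_ind (P := P)); apply=> // s1 s2 s3.
rewrite /P !eval_cat !mulgA => ->; congr (_ * _).
by have := comM (nth 1 [:: eval phi s1; eval phi s2]); rewrite /id_comm !evalE.
Qed.

Lemma once_comm (M : monoidType) u v x y :
    satisfies M (u, v) -> x != y ->
    filter (pred2 x y) u = [:: x; y] -> filter (pred2 x y) v = [:: y; x] ->
  satisfies M id_comm.
Proof.
move=> uv nxy fu fv phi.
have := uv (fun z => if z == x then phi 0 else if z == y then phi 1%N else 1).
have off_xy (w : word) z : z \in w -> ~~ pred2 x y z ->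
    (if z == x then phi 0 else if z == y then phi 1%N else 1) = 1.
  by move=> _; rewrite negb_or => /andP[/negPf-> /negPf->].
rewrite /= (eval_filter (off_xy u)) (eval_filter (off_xy v)) fu fv.
by rewrite /id_comm !evalE !eqxx eq_sym (negPf nxy).
Qed.

Lemma determination u v :
  (forall M, V M -> satisfies M (u, v)) -> satisfies N (u, v).
Proof.
move=> Vuv.
have Vvu M : V M -> satisfies M (v, u) by move=> VM phi; rewrite /= (Vuv _ VM).
have trivial_N : satisfies N id_triv -> satisfies N (u, v).
  move=> triv phi; have all1 w : eval phi w = 1.
    elim: w => [|x w IHw]; first exact: eval_nil.
    by rewrite eval_cons IHw; have := triv (fun=> phi x); rewrite /id_triv
      !evalE.
  by rewrite !all1.
have [eq_uv|/existsNP[x neq_x]] := pselect (u =i v); last first.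
  apply/trivial_N/sepN => [|M VM]; first by constructor 1.
  case xu: (x \in u); case xv: (x \in v); try by case: neq_x; rewrite xu xv.
    by apply: (content_triv (bV VM) (Vuv _ VM) xu); rewrite xv.
  by apply: (content_triv (bV VM) (Vvu _ VM) xv); rewrite xu.
have [once_uv|/existsNP[x neq_x]] :=
    pselect (forall x, (count_mem x u == 1%N) = (count_mem x v == 1%N)); last
      first.
  have idemN : satisfies N id_idem.
    apply: sepN => [|M VM]; first by constructor 1.
    have gt1 w : x \in w -> count_mem x w != 1%N -> 1 < count_mem x w.
      by move=> xw nx1; rewrite ltn_neqAle eq_sym nx1 -has_count has_pred1.
    case xu: (count_mem x u == 1%N); case xv: (count_mem x v == 1%N);
      try by case: neq_x; rewrite xu xv.
      apply: (once_idem (bV VM) (Vuv _ VM) (eqP xu)); apply: gt1; rewrite ?xv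
        //.
      by rewrite -eq_uv -has_pred1 has_count (eqP xu).
    apply: (once_idem (bV VM) (Vvu _ VM) (eqP xv)); apply: gt1; rewrite ?xu //.
    by rewrite eq_uv -has_pred1 has_count (eqP xv).
  move=> phi.
  (* All elements of [N] being idempotent, no letter has to serve as a separator and each side is a
     single block. *)
  have : agree pred0 [::] N (fun=> u) (fun=> v).
    apply: agree_blocks_separating => // [z|M VM psi _]; rewrite /blockw !prefw0
      //.
    exact: Vuv.
  move/(_ phi); rewrite /blockw !prefw0; apply=> z _.
  by have := idemN (fun=> phi z); rewrite /id_idem !evalE.
have [eq_ts|neq_ts] := eqVneq [seq x <- u | count_mem x u == 1%N]
                               [seq x <- v | count_mem x u == 1%N].
  exact: determine_once.
set S := fun x => count_mem x u == 1%N in neq_ts.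
have uniq_u : uniq (filter S u) := uniq_once u.
have uniq_v : uniq (filter S v).
  by rewrite (eq_filter once_uv); apply: uniq_once.
have perm_ts : perm_eq (filter S u) (filter S v).
  by apply: uniq_perm => // z; rewrite !mem_filter eq_uv.
(* Were there no inverted pair, [bubble_sort] for equality would identify the two sequences. *)
have [x [y [fu fv]]] : exists x y, inverted x y (filter S u) (filter S v).
  apply: contra_notP (negP neq_ts) => no_inv; apply/eqP.
  apply: bubble_sort => // [a b c -> //|x y inv_xy].
  by case: no_inv; exists x, y.
have nxy : x != y.
  by have := filter_uniq (pred2 x y) uniq_u; rewrite fu /= mem_seq1 andbT.
have [Sx Sy] : S x /\ S y.
  have := mem_head x [:: y]; have := mem_last x [:: y].
  by rewrite -fu !mem_filter => /and3P[_ Sy _] /and3P[].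
have fS w : filter (pred2 x y) (filter S w) = filter (pred2 x y) w.
  rewrite -filter_predI; apply: eq_filter => z /=.
  by case: eqP => [->|_]; last case: eqP => [->|//].
have commV M : V M -> satisfies M id_comm.
  by move=> VM; apply: (once_comm (Vuv _ VM) nxy); rewrite -fS.
have commN : satisfies N id_comm by apply: sepN => //; constructor 1.
(* Commutativity moves the letters occurring once to the front, in the same order on both sides, so
   that [determine_once] applies. *)
pose u' := filter S u ++ filter (predC S) u.
pose v' := filter S u ++ filter (predC S) v.
have pu : perm_eq u u' by rewrite perm_sym; apply/permPl/perm_filterC.
have pv : perm_eq v v'.
  rewrite perm_sym (perm_trans (y := filter S v ++ filter (predC S) v)) //.
    by rewrite perm_cat2r.
  exact/permPl/perm_filterC.
have Vuv' M : V M -> satisfies M (u', v').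
  move=> VM phi /=; rewrite -(eval_perm _ (commV _ VM) pu).
  by rewrite -(eval_perm _ (commV _ VM) pv); apply: Vuv.
have cu z : count_mem z u' = count_mem z u by rewrite (permP pu).
have cv z : count_mem z v' = count_mem z v by rewrite (permP pv).
have fS' w : [seq z <- filter S u ++ filter (predC S) w | count_mem z u' == 1%N]
  =
    filter S u.
  rewrite (eq_filter (a2 := S)) => [|z]; last by rewrite cu.
  rewrite filter_cat filter_id -filter_predI (eq_filter (a1 := predI _ _) (a2 :=
    pred0)).
    by rewrite filter_pred0 cats0.
  by move=> z; apply: andbN.
move=> phi /=; rewrite (eval_perm _ commN pu) (eval_perm _ commN pv).
apply: (@determine_once u' v') => [z|z||].
- by rewrite -(perm_mem pu) -(perm_mem pv).
- by rewrite cu cv.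
- by rewrite !fS'.
exact: Vuv'.
Qed.

End Determination.

(** * Implications between the separating identities *)

Section Implications.
Variable M : monoidType.
Hypothesis bM : basic M.

Lemma gap_fill_sigma1 : gap_fill M -> sigma 1 M.
Proof.
move=> c1 e f [|h [|//]] //= ee ff _; rewrite !mulg1.
by have := c1 e h f ee; rewrite -(mulgA _ e f) -(mulgA _ (e * f)) idem_absorb //
  !mulgA.
Qed.

Lemma sigmaS n : sigma n M -> sigma n.+1 M.
Proof.
move=> sM e f [|h hs] //= ee ff [size_hs].
by rewrite -!(mulgA (e * h)) (sM f e).
Qed.

Lemma sigma_le n p : n <= p -> sigma n M -> sigma p M.
Proof. by move/subnKC<-; elim: (p - n) => [|d IHd] /=; rewrite ?addn0 ?addnS //
  => /IHd/sigmaS. Qed.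

Lemma alt_absorb n (e f : M) :
  idem e -> idem f -> e * f * alt e f (nseq n 1) = e * f.
Proof.
move=> ee ff; suff: e * f * alt e f (nseq n 1) = e * f /\
                    e * f * alt f e (nseq n 1) = e * f by case.
elim: n => [|n [IHe IHf]] /=; first by rewrite mulg1.
rewrite !mulg1 !mulgA idem_absorb // -(mulgA e f f) ff.
by rewrite IHe IHf.
Qed.

(** With all h_i = 1, a factor e f on the left absorbs the alternating product and leaves the free
    factor h. *)
Lemma sigma_sigma_inf n : sigma n M -> sigma_inf M.
Proof.
move=> sM e f h ee ff.
have := sigma_mulr h sM ee ff (size_nseq n (1 : M)).
by move/(congr1 (fun z => e * f * z)); rewrite /= !mulgA alt_absorb.
Qed.

Lemma collapsing_gap_fill e : e \in collapsing -> satisfies M e -> gap_fill M.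
Proof.
rewrite !inE => /or4P[/eqP->|/eqP->|/eqP->|/or3P[]/eqP->] sM.
- have all1 (x : M) : x = 1 by have := sM (fun=> x); rewrite /id_triv !evalE.
  by move=> e0 t s _; rewrite [LHS]all1 [RHS]all1.
- have all_idem (x : M) : idem x.
    by have := sM (fun=> x); rewrite /id_idem !evalE => xx; rewrite /idem -xx.
  by move=> e0 t s ee; rewrite idem_absorb.
- have comm (x y : M) : x * y = y * x.
    by have := sM (nth 1 [:: x; y]); rewrite /id_comm !evalE.
  by move=> e0 t s ee; rewrite -(mulgA e0 t) (comm t e0) mulgA ee.
- exact/satisfies_gap_fill.
- by move: sM => /(satisfies_right_fill bM) c2 e0 t s ee; rewrite c2.
move: sM => /(satisfies_left_fill bM) c2' e0 t s ee.
by rewrite -!mulgA; congr (_ * (_ * _)); rewrite mulgA c2'.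
Qed.

End Implications.

(** * The variety of E^1 and bases of its subvarieties *)

Lemma basic_E1 : basic E1.
Proof.
move=> e; rewrite !inE => /or3P[] /eqP -> phi; rewrite !evalE /=.
- by case: (phi 0) => [[]|]; case: (phi 1%N) => [[]|].
- by case: (phi 0) => [[]|].
by case: (phi 0) => [[]|]; case: (phi 1%N) => [[]|].
Qed.

Lemma E1_not_sigma_infty : ~ satisfies E1 sigma_infty.
Proof.
(* As bc = b, cb = c and ba = a, the left side becomes ab = 0 and the right side ac. *)
pose x : E1 := Some Eb; pose y : E1 := Some Ec; pose h : E1 := Some Ea.
by move/(_ (nth 1 [:: x; y; h])); rewrite /sigma_infty !evalE.
Qed.

Definition holds (V : monoid_class) (e : identity) : bool :=
  `[< forall M, V M -> satisfies M e >].

Lemma separating_sigma_inf M e :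
  basic M -> separating e -> satisfies M e -> sigma_inf M.
Proof.
move=> bM [coll_e|[n ->]|->].
- by move/(collapsing_gap_fill bM coll_e)/(gap_fill_sigma1 bM)/(sigma_sigma_inf
  bM).
- by move/(satisfies_sigma bM)/(sigma_sigma_inf bM).
- by move/(satisfies_sigma_inf bM).
Qed.

(** Every separating identity implies [sigma_inf], which fails in E^1. So E^1 satisfies no
    separating identity, and [determination] passes all its identities to every basic monoid. *)
Lemma EE1P N : EE1 N <-> basic N.
Proof.
split=> [EN|bN V [Sig VSig] /VSig E1Sig].
  by apply: (EN basic); [exists (fun e => e \in EE1_basis) | exact: basic_E1].
apply/VSig => -[u v] Sig_uv.
apply: (determination (V := eq E1)) => // [M <-||M <-]; first exact: basic_E1.
  move=> e sep_e /(_ _ erefl)/(separating_sigma_inf basic_E1 sep_e).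
  by move/(satisfies_sigma_inf basic_E1)/E1_not_sigma_infty.
exact: E1Sig.
Qed.

Lemma variety_base (V : monoid_class) (s : seq identity) :
    is_variety V -> (forall M, V M -> basic M) ->
    (forall e, e \in s -> holds V e) ->
    (forall N e, basic N -> (forall e, e \in s -> satisfies N e) ->
       separating e -> holds V e -> satisfies N e) ->
  same_class V (models (fun e => e \in EE1_basis ++ s)).
Proof.
move=> [Sig VSig] bV Vs sepV N; split=> [VN e|N_s].
  rewrite mem_cat => /orP[|/Vs/asboolP]; last exact.
  by apply: (bV N VN).
have bN : basic N by move=> e e_b; apply: N_s; rewrite mem_cat e_b.
apply/VSig => -[u v] Sig_uv; apply: (determination bV bN) => [e sep_e Ve|M
  /VSig]; last exact.
apply: sepV => //; last exact/asboolP.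
by move=> d ds; apply: N_s; rewrite mem_cat ds orbT.
Qed.

Definition separating_upto n : seq identity :=
  collapsing ++ [seq id_sigma i | i <- iota 0 n.+1].

(** Since sigma_n implies sigma_oo and sigma_p for p >= n, only finitely many separating identities
    remain to be recorded. *)
Lemma bounded_base (V : monoid_class) n :
    is_variety V -> (forall M, V M -> basic M) -> holds V (id_sigma n) ->
  same_class V
    (models (fun e => e \in EE1_basis ++ filter (holds V) (separating_upto n))).
Proof.
move=> varV bV Vn; apply: variety_base => // [e|N e bN Ns sep_e Ve].
  by rewrite mem_filter => /andP[].
have Nn : sigma n N.
  apply/(satisfies_sigma bN)/Ns; rewrite mem_filter Vn mem_cat.
  by rewrite map_f ?orbT // mem_iota /= add0n.
case: sep_e Ve => [coll_e|[p ->]|->] Ve.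
- by apply: Ns; rewrite mem_filter Ve mem_cat coll_e.
- have [le_pn|/ltnW le_np] := leqP p n; last exact/(satisfies_sigma
  bN)/(sigma_le le_np).
  by apply: Ns; rewrite mem_filter Ve mem_cat map_f ?orbT // mem_iota /= add0n.
- exact/(satisfies_sigma_inf bN)/(sigma_sigma_inf bN Nn).
Qed.

(** A collapsing identity would imply sigma_1. *)
Lemma unbounded_separating (V : monoid_class) e :
    (forall M, V M -> basic M) -> (forall n, ~~ holds V (id_sigma n)) ->
  separating e -> holds V e -> e = sigma_infty.
Proof.
move=> bV unb [coll_e|[n ->]|//] Ve; last by case/negP: (unb n).
case/negP: (unb 1%N); apply/asboolP => M VM; have bM := bV M VM.
apply/(satisfies_sigma bM)/(gap_fill_sigma1 bM)/(collapsing_gap_fill bM coll_e).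
by move/asboolP: Ve; apply.
Qed.

Lemma unbounded_base (V : monoid_class) :
    is_variety V -> (forall M, V M -> basic M) ->
    (forall n, ~~ holds V (id_sigma n)) ->
  same_class V
    (models (fun e => e \in EE1_basis ++ filter (holds V) [:: sigma_infty])).
Proof.
move=> varV bV unb; apply: variety_base => // [e|N e bN Ns sep_e Ve].
  by rewrite mem_filter => /andP[].
by apply: Ns; rewrite mem_filter Ve (unbounded_separating bV unb sep_e Ve)
  mem_head.
Qed.

Lemma EE1_hereditarily_finitely_based : hereditarily_finitely_based EE1.
Proof.
move=> V [varV subV]; have bV M : V M -> basic M by move=> /subV/EE1P.
have [[n Vn]|unb] := pselect (exists n, holds V (id_sigma n)).
  by eexists; apply: (bounded_base varV bV Vn).
eexists; apply: (unbounded_base varV bV) => n.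
by apply/negP => Vn; apply: unb; exists n.
Qed.

Lemma bounded_small (V : monoid_class) n :
  (forall M, V M -> basic M) -> holds V (id_sigma n) -> small V.
Proof.
move=> bV Vn; set s := separating_upto n.
(* A subvariety inherits sigma_n, so it is determined by the members of [s] that hold in it,
   recorded as a bit vector. *)
exists #|{: (size s).-tuple bool}|, (fun i =>
  models (fun e => e \in EE1_basis ++ mask (enum_val i : (size s).-tuple bool)
    s)).
move=> W [varW subW]; exists (enum_rank (map_tuple (holds W) (in_tuple s))).
rewrite enum_rankK -filter_mask; apply: bounded_base => // [M /subW/bV//|].
by move/asboolP: Vn => Vn; apply/asboolP => M /subW/Vn.
Qed.

(** Quotients by such congruences provide both the relatively free monoids and the transition
    monoids of automata. *)
Record word_congruence := WordCongruence {
  congr_rel :> word -> word -> Prop;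
  congr_refl : forall u, congr_rel u u;
  congr_sym : forall u v, congr_rel u v -> congr_rel v u;
  congr_trans : forall u v w, congr_rel u v -> congr_rel v w -> congr_rel u w;
  congr_cat : forall u u' v v',
    congr_rel u u' -> congr_rel v v' -> congr_rel (u ++ v) (u' ++ v') }.

(** * Finite generation *)

Section Quotient.
Variable R : word_congruence.
Implicit Types u v w : word.

(** Choice depends only on the predicate up to equivalence, so congruent words get the same
    representative and the quotient is a subtype of words. *)
Definition class_rep u : word := choose (fun v => `[< R u v >]) u.

Lemma class_repP u : R u (class_rep u).
Proof. by apply/asboolP/(@chooseP _ (fun v => `[< R u v >]));
  apply/asboolP/congr_refl. Qed.

Lemma eq_class_rep u v : R u v -> class_rep u = class_rep v.
Proof.
move=> Ruv; have eqR : (fun w => `[< R u w >]) =1 (fun w => `[< R v w >]).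
  move=> w; apply/asboolP/asboolP => [Ruw|Rvw].
    exact: congr_trans (congr_sym Ruv) Ruw.
  exact: congr_trans Ruv Rvw.
rewrite /class_rep (eq_choose eqR); apply: choose_id; apply/asboolP.
  exact: congr_sym.
exact: congr_refl.
Qed.

Lemma class_rep_id u : class_rep (class_rep u) == class_rep u.
Proof. by apply/eqP/esym/eq_class_rep/class_repP. Qed.

Definition quot : Type := {u : word | class_rep u == u}.

HB.instance Definition _ := Choice.on quot.

Definition quot_class u : quot := exist _ (class_rep u) (class_rep_id u).

Lemma quot_classP u v : quot_class u = quot_class v <-> R u v.
Proof.
split=> [[eq_uv]|Ruv]; last by apply: val_inj; apply: eq_class_rep.
apply: congr_trans (class_repP u) _; rewrite eq_uv.
exact/congr_sym/class_repP.
Qed.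

Lemma quot_classK (x : quot) : quot_class (val x) = x.
Proof. by apply: val_inj; apply/eqP/(valP x). Qed.

Definition quot_mul (x y : quot) : quot := quot_class (val x ++ val y).

Lemma quot_class_cat u v : quot_class (u ++ v) = quot_mul (quot_class u)
  (quot_class v).
Proof. by apply/quot_classP/congr_cat; apply: class_repP. Qed.

Fact quot_mulA : associative quot_mul.
Proof.
move=> x y z; rewrite -(quot_classK x) -(quot_classK y) -(quot_classK z).
by rewrite -!quot_class_cat catA.
Qed.

Fact quot_mul1g : left_id (quot_class [::]) quot_mul.
Proof. by move=> x; rewrite -(quot_classK x) -quot_class_cat. Qed.

Fact quot_mulg1 : right_id (quot_class [::]) quot_mul.
Proof. by move=> x; rewrite -(quot_classK x) -quot_class_cat cats0. Qed.

HB.instance Definition _ :=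
  isMonoid.Build quot quot_mulA quot_mul1g quot_mulg1.

Definition subst_word (f : nat -> word) w : word := flatten [seq f x | x <- w].

Lemma eval_quot_class (f : nat -> word) w :
  eval (fun x => quot_class (f x) : quot) w = quot_class (subst_word f w).
Proof.
elim: w => [|x w IHw]; first exact: eval_nil.
by rewrite eval_cons IHw -[LHS]/(quot_mul _ _) -quot_class_cat.
Qed.

Lemma quot_satisfies e :
  satisfies quot e <->
  forall f : nat -> word, R (subst_word f e.1) (subst_word f e.2).
Proof.
split=> [sat_e f|R_e phi]; first by apply/quot_classP; rewrite
  -!eval_quot_class; apply: sat_e.
pose f x := val (phi x); have phiE w : eval phi w = quot_class (subst_word f w).
  by rewrite -eval_quot_class; apply: eq_in_eval => x _; rewrite quot_classK.
by rewrite !phiE; apply/quot_classP/R_e.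
Qed.

Lemma subst_letters w : subst_word (fun x => [:: x]) w = w.
Proof. by rewrite /subst_word; elim: w => //= x w ->. Qed.

Lemma quot_finite (T : finType) (g : word -> T) :
  (forall u v, g u = g v -> R u v) -> finite_monoid quot.
Proof.
move=> gR; pose pre t : word :=
  if pselect (exists w, g w = t) is left ex_w then projT1 (cid ex_w) else [::].
exists [seq quot_class (pre t) | t <- enum T] => x; rewrite -(quot_classK x).
apply/mapP; exists (g (val x)); first by rewrite mem_enum.
apply/quot_classP/gR; rewrite /pre; case: pselect => [ex_w|[]]; last by exists
  (val x).
by case: (cid ex_w).
Qed.

End Quotient.

Section RelativelyFree.
Variables (V : monoid_class) (k : nat).

(** Letters from k on are sent to 1, so the quotient of the words over all letters is the relatively
    free monoid on k generators. *)
Definition free_rel (u v : word) : Prop := forall M, V M ->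
  forall phi : nat -> M, (forall z, k <= z -> phi z = 1) -> eval phi u = eval
    phi v.

Program Definition free_congruence : word_congruence :=
  @WordCongruence free_rel _ _ _ _.
Next Obligation. by []. Qed.
Next Obligation. by move=> M VM phi phi1; rewrite (H M). Qed.
Next Obligation. by move=> M VM phi phi1; rewrite (H M) // (H0 M). Qed.
Next Obligation.
by move=> M VM phi phi1; rewrite !eval_cat (H M) // (H0 M).
Qed.

Definition free_monoid : monoidType := quot free_congruence.

Lemma eval_subst (M : monoidType) (phi : nat -> M) f w :
  eval phi (subst_word f w) = eval (fun x => eval phi (f x)) w.
Proof. by elim: w => [|x w IHw]; rewrite ?eval_nil // /subst_word /= eval_cat
  eval_cons IHw. Qed.

Lemma free_satisfies e : (forall M, V M -> satisfies M e) -> satisfies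
  free_monoid e.
Proof.
move=> Ve; apply/quot_satisfies => f M VM phi _.
by rewrite !eval_subst; apply: Ve.
Qed.

Lemma free_reflects e : (forall z, z \in e.1 ++ e.2 -> z < k) ->
  satisfies free_monoid e -> forall M, V M -> satisfies M e.
Proof.
move=> small_e /quot_satisfies/(_ (fun x => [:: x])).
rewrite !subst_letters => free_e M VM phi.
have restr w : {subset w <= e.1 ++ e.2} ->
    eval phi w = eval (fun z => if z < k then phi z else 1) w.
  by move=> sub_w; apply: eq_in_eval => z /sub_w/small_e ->.
rewrite !restr => [|z ze|z ze]; rewrite ?mem_cat ?ze ?orbT //.
by apply: free_e => // z; rewrite ltnNge => ->.
Qed.

(** Monoids of [V] satisfy the identities of E^1, so a class is determined by the evaluations of its
    words in E^1 at k letters, for which there are finitely many possibilities. *)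
Lemma free_finite : (forall M, V M -> basic M) -> finite_monoid free_monoid.
Proof.
move=> bV; pose phi (c : {ffun 'I_k -> option E}) z : E1 :=
  if insub z is Some i then c i : E1 else 1.
apply: (@quot_finite _ {ffun {ffun 'I_k -> option E} -> option E}
  (fun w => [ffun c => eval (phi c) w])).
move=> u v /ffunP eq_uv M VM psi psi1.
have E1_uv : satisfies E1 ([seq x <- u | x < k], [seq x <- v | x < k]).
  move=> chi /=; have := eq_uv [ffun i : 'I_k => chi i]; rewrite !ffunE.
  have restr w : eval (phi [ffun i : 'I_k => chi i]) w =
      eval chi [seq x <- w | x < k].
    rewrite (eval_filter (P := fun x => x < k)) => [|z _ /= ge_zk].
      by apply: eq_in_eval => z; rewrite mem_filter /phi => /andP[lt_zk _];
        rewrite insubT ffunE.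
    by rewrite /phi insubF //; apply: negbTE.
  by rewrite !restr.
have restr w : eval psi w = eval psi [seq x <- w | x < k].
  by apply: eval_filter => z _; rewrite -leqNgt => /psi1.
set e := ([seq x <- u | x < k], [seq x <- v | x < k]) in E1_uv.
have /EE1P EM := bV M VM; have: models (eq e) M.
  by apply: (EM (models (eq e))); [exists (eq e) | move=> _ <-].
by move/(_ e erefl psi); rewrite (restr u) (restr v).
Qed.

End RelativelyFree.

Lemma small_finitely_generated (V : monoid_class) :
    is_variety V -> (forall M, V M -> basic M) -> small V ->
  finitely_generated V.
Proof.
move=> varV bV [n [F F_all]].
pose distinguishes i e := (forall M, F i M -> satisfies M e) /\
                          exists2 M, V M & ~ satisfies M e.
have /choice[d dP] i :
    exists e', (exists e, distinguishes i e) -> distinguishes i e'.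
  have [[e e_i]|no_e] := pselect (exists e, distinguishes i e); first by exists
    e.
  by exists ([::], [::]) => /no_e.
(* Large enough that all chosen identities d i use only letters below k. *)
pose k := (\max_(i < n) \max_(z <- (d i).1 ++ (d i).2) z).+1.
pose Fr := free_monoid V k.
have subV M : generated_variety Fr M -> V M.
  move=> gen_M; apply: gen_M => //; case: varV => Sig VSig.
  apply/VSig => e Sig_e; apply: free_satisfies => M' /VSig; exact.
(* Were the variety generated by [Fr], which is some F i, smaller than V, then d i would hold in
   [Fr] and fail in V; [free_reflects] excludes this. *)
have [i FrFi] : exists i, same_class (generated_variety Fr) (F i).
  by apply: F_all; split=> //; apply: is_variety_generated.
exists Fr; first exact: free_finite.
move=> N; split=> [VN|/subV//]; case: (is_variety_generated Fr) => Sig genSig.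
apply/genSig => e Sig_e; apply: contrapT => Ne.
have [Fi_e [M VM M_e]] : distinguishes i (d i).
  apply: dP; exists e; split; last by exists N.
  by move=> M /FrFi/genSig; apply.
apply: M_e; apply: (free_reflects (k := k)) VM => [z z_d|].
  rewrite ltnS; apply: leq_trans (leq_bigmax i).
  exact: leq_bigmax_seq.
by apply/Fi_e/FrFi => W _; apply.
Qed.

Lemma same_finitely_generated (V W : monoid_class) :
  same_class V W -> finitely_generated W -> finitely_generated V.
Proof.
by move=> VW [M finM WM]; exists M => // N; rewrite VW.
Qed.

Lemma EE1_finitely_generated : finitely_generated EE1.
Proof.
exists E1 => //; exists (enum (option E : finType)) => x.
by rewrite mem_enum.
Qed.

(** * Monoids failing sigma_n *)

Section Automaton.
Variable n : nat.
Local Open Scope nat_scope.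

(* States below n count the markers h_(s+1) = s + 2 read so far; the only other
   letter read in such a state s is the one of x = 0, y = 1 prescribed by
   the parity of s. In state n the next letter must be x, and afterwards (state
   n + 1) x and y are free. *)
Definition step (s z : nat) : option nat :=
  if z is z'.+2 then if (s == z') && (s < n) then Some s.+1 else None
  else if s < n then if z == odd s then Some s else None
  else if s == n then if z == 0 then Some s.+1 else None
  else Some s.

Definition run (o : option nat) (w : word) : option nat :=
  foldl (fun o' z => obind (step ^~ z) o') o w.

Lemma run_cat o u v : run o (u ++ v) = run (run o u) v.
Proof. exact: foldl_cat. Qed.

Lemma run_None w : run None w = None.
Proof. by elim: w. Qed.

Lemma run_homo s w s' : run (Some s) w = Some s' -> s <= s'.
Proof.
elim: w s => [|z w IHw] s /=; first by case=> ->.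
case step_s: (step s z) => [t|]; last by rewrite run_None.
move=> /IHw; apply: leq_trans; move: step_s; rewrite /step.
by case: z => [|[|z]]; do 3?case: ifP => _ //; case=> <-.
Qed.

Lemma run_marker s w s' z :
  run (Some s) w = Some s' -> z.+2 \in w -> s <= z < s'.
Proof.
move=> + /splitPr def_w; case: def_w => w1 w2; rewrite run_cat /=.
case run1: (run _ w1) => [t|]; last by rewrite run_None.
rewrite /=; case: ifP => [/andP[/eqP <- _]|_]; last by rewrite run_None.
by move=> /run_homo ->; rewrite (run_homo run1).
Qed.

(** States never decrease, and a marker raises the state beyond the only one in which it can be
    read. *)
Lemma run_twice o u v z : z.+2 \in u -> z.+2 \in v -> run o (u ++ v) = None.
Proof.
move=> zu zv; rewrite run_cat; case: o => [s|]; last by rewrite !run_None.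
case run_u: (run _ u) => [t|]; last by rewrite run_None.
case run_v: (run _ v) => [s'|] //.
have /andP[_ lt_zt] := run_marker run_u zu.
by have /andP[] := run_marker run_v zv; rewrite leqNgt lt_zt.
Qed.

Definition low (w : word) := all (fun z => z < 2) w.

Lemma run_low s w : low w ->
  run (Some s) w =
    if s < n then if all (pred1 (nat_of_bool (odd s))) w then Some s else None
    else if s == n then
      if w is z :: _ then if z == 0 then Some n.+1 else None else Some n
    else Some s.
Proof.
have high t v : low v -> n < t -> run (Some t) v = Some t.
  elim: v => //= z v IHv /andP[z_low v_low] lt_nt.
  have -> : step t z = Some t; last exact: IHv.
  by case: z z_low => [|[]] // _; rewrite /step ltnNge (ltnW lt_nt) (gtn_eqF
    lt_nt).
elim: w => [|z w IHw] /=; first by case: ifP => // _; case: eqP => [->|].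
move=> /andP[z_low w_low].
have step_low : step s z = if s < n then if z == odd s then Some s else None
  else if s == n then if z == 0 then Some s.+1 else None else Some s.
  by case: z z_low => [|[]].
rewrite step_low; case: ltnP => [lt_sn|le_ns].
  by case: ifP; rewrite ?run_None // IHw // lt_sn.
case: eqP => [->|/eqP neq_sn].
  by case: ifP; rewrite ?run_None // high.
by rewrite high // ltn_neqAle eq_sym neq_sn.
Qed.

Lemma lowP w : reflect (exists z, z.+2 \in w) (~~ low w).
Proof.
apply: (iffP allPn) => [[[|[|z]] // zw _]|[z zw]]; first by exists z.
by exists z.+2.
Qed.

Definition same_run (u v : word) : Prop := forall o, run o u = run o v.

Program Definition run_congruence : word_congruence :=
  @WordCongruence same_run _ _ _ _.
Next Obligation. by []. Qed.
Next Obligation. by move=> o; rewrite H. Qed.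
Next Obligation. by move=> o; rewrite H. Qed.
Next Obligation. by move=> o; rewrite !run_cat H H0. Qed.

Lemma same_run_twice u v z : 1 < count_mem z.+2 u -> 1 < count_mem z.+2 v ->
  same_run u v.
Proof.
have dead w : 1 < count_mem z.+2 w -> forall o, run o w = None.
  move=> cw o; have /splitPr def_w : z.+2 \in w.
    by rewrite -has_pred1 has_count ltnW.
  case: def_w cw => w1 w2; rewrite count_cat /= eqxx addnCA ltnS -count_cat.
  rewrite -has_count has_pred1 mem_cat => /orP[zw|zw].
    by apply: run_twice zw _; rewrite mem_head.
  rewrite -cat_rcons; apply: run_twice _ zw.
  by rewrite mem_rcons mem_head.
by move=> /dead cu /dead cv o; rewrite cu cv.
Qed.

Lemma run_low_dup w : low w -> same_run (w ++ w) w.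
Proof.
move=> w_low [s|]; last by rewrite !run_None.
rewrite !run_low //; last by rewrite /low all_cat andbb.
by rewrite all_cat andbb; case: (w).
Qed.

End Automaton.

Definition automaton_monoid n : monoidType := quot (run_congruence n).

Lemma automaton_sigma n : ~ satisfies (automaton_monoid n) (id_sigma n).
Proof.
move=> /quot_satisfies/(_ (fun x => [:: x]))/(_ (Some 0%N)).
rewrite !subst_letters /= !run_cat.
(* Generalised to reading the last q markers from state p, whose parity tells which of x and y is
   due. *)
have run_altw p q : (p + q)%N = n ->
    run n (Some p) (alt_word (odd p) (~~ odd p) p.+2 q) = Some n.
  elim: q p => [|q IHq] p def_n /=; first by rewrite addn0 in def_n; rewrite
    def_n.
  have lt_pn : p < n by rewrite -def_n addnS ltnS leq_addr.
  have step_p : step n p (odd p) = Some p.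
    by rewrite /step lt_pn; case: (odd p).
  rewrite step_p /= step_p /= eqxx lt_pn /=.
  by have := IHq p.+1; rewrite /= negbK; apply; rewrite addSnnS.
(* From state n the word x^2 y^2 survives while y^2 x^2 dies. *)
by rewrite (run_altw 0%N) // !run_low //= ltnn eqxx.
Qed.

Section AutomatonSatisfies.
Variable n : nat.
Local Open Scope nat_scope.
Implicit Types X Y H : word.

(** A value that contains a marker and is used twice kills both sides, so repeated variables may be
    assumed to take marker-free values. *)
Lemma high_twice X u1 u2 u3 v1 v2 v3 :
  ~~ low X -> same_run n (u1 ++ X ++ u2 ++ X ++ u3) (v1 ++ X ++ v2 ++ X ++ v3).
Proof.
move=> /lowP[z zX]; have cX : 0 < count_mem z.+2 X by rewrite -has_count
  has_pred1.
have c2 a b c : 1 < count_mem z.+2 (a ++ X ++ b ++ X ++ c).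
  by rewrite !count_cat; lia.
exact: same_run_twice (c2 _ _ _) (c2 _ _ _).
Qed.

Lemma run_dup o X : low X -> run n (run n o X) X = run n o X.
Proof. by move=> lX; rewrite -run_cat run_low_dup. Qed.

Lemma low_cat X Y : low X -> low Y -> low (X ++ Y).
Proof. by rewrite /low all_cat => -> ->. Qed.

Lemma run_absorb o X Y : low X -> low Y ->
  run n (run n (run n o X) Y) X = run n (run n o X) Y.
Proof.
move=> lX lY; rewrite -!run_cat; case: o => [s|]; last by rewrite !run_None.
rewrite !run_low ?low_cat // !all_cat.
case: ifP => _; first by do 2?case: (all _ _).
by case: (X) => //; case: (Y) => //=; rewrite ?cats0.
Qed.

Lemma run_swap o H X Y : low X -> low Y ->
  run n (run n (run n (run n (run n o X) Y) H) X) Y =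
  run n (run n (run n (run n (run n o X) Y) H) Y) X.
Proof.
move=> lX lY; rewrite -(run_cat n o) -!(run_cat n (run n (run n o _) _)).
case: o => [s|]; last by rewrite !run_None.
case run_t: (run n (Some s) (X ++ Y)) => [t|]; last by rewrite !run_None.
case run_r: (run n (Some t) H) => [r|]; last by rewrite !run_None.
have le_tr := run_homo run_r.
rewrite !run_low ?low_cat // !all_cat [in RHS]andbC.
(* Except in state n the runs on X Y and Y X agree, and in state n only the first letter matters. *)
case: ifP => // _; case: eqP => // def_r; rewrite def_r {run_r def_r} in le_tr.
move: run_t; rewrite run_low ?low_cat //.
case: X {lX} => [|x X]; first by rewrite cats0.
case: Y {lY} => [|y Y]; first by rewrite cats0.
(* Below state n the earlier X Y survives only if all its letters are equal, so X and Y start alike.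
   From state n it leads to n + 1, and no run returns to n. *)
rewrite all_cat /=; case: ifP => [_|ge_sn].
  by case: ifP => // /andP[/andP[/eqP -> _] /andP[/eqP -> _]].
case: eqP => [_|neq_sn].
  by case: ifP => // _ [def_t]; move: le_tr; rewrite -def_t ltnn.
by case=> def_t; lia.
Qed.

Lemma automaton_basic : basic (automaton_monoid n).
Proof.
move=> e; rewrite !inE => /or3P[] /eqP ->; apply/quot_satisfies => f;
  rewrite /subst_word /=; move: (f 0) (f 1) => X H.
- have [lX|hX] := boolP (low X).
    by move=> o; rewrite !run_cat !run_dup.
  exact: (high_twice [::] H [::] [::] [::] (H ++ X ++ X ++ [::])).
- have [lX|hX] := boolP (low X).
    by move=> o; rewrite !run_cat !run_dup.
  exact: (high_twice [::] [::] (X ++ [::]) [::] [::] [::]).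
have [lX|hX] := boolP (low X); last first.
  exact: (high_twice [::] [::] _ [::] [::]).
have [lH|hH] := boolP (low H); last first.
  have := high_twice (X ++ X) [::] (X ++ X ++ [::]) (X ++ X) [::] [::] hH.
  by rewrite -!catA.
by move=> o; rewrite !run_cat !run_dup // run_absorb.
Qed.

Lemma automaton_sigma_infty : satisfies (automaton_monoid n) sigma_infty.
Proof.
apply/quot_satisfies => f; rewrite /subst_word /=.
move: (f 0) (f 1) (f 2) => X Y H.
have [lX|hX] := boolP (low X); last first.
  exact: (high_twice [::] [::] _ [::] [::]).
have [lY|hY] := boolP (low Y); last first.
  have := high_twice (X ++ X) [::] (H ++ X ++ X ++ Y ++ Y ++ [::])
                     (X ++ X) [::] (H ++ Y ++ Y ++ X ++ X ++ [::]) hY.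
  by rewrite -!catA.
by move=> o; rewrite !run_cat !run_dup // run_swap.
Qed.

End AutomatonSatisfies.

(** * Finite monoids satisfying sigma_oo *)

Lemma finite_sigma (M : monoidType) :
  basic M -> finite_monoid M -> sigma_inf M -> exists n, sigma n M.
Proof.
move=> bM [s finM] sM; exists (size s).+1.*2 => e f hs ee ff size_hs.
(* Prefixes of even length are used so that what follows starts with e again. Two of the first |s| +
   1 prefixes have the same value. *)
pose P k := alt e f (take k.*2 hs).
have alt_cat h1 h2 : ~~ odd (size h1) ->
    alt e f (h1 ++ h2) = alt e f h1 * alt e f h2.
  have [m] := ubnP (size h1); elim: m h1 => // m IHm [|h [|h' h1]] //=.
    by rewrite mul1g.
  by rewrite negbK => lt_m ev; rewrite IHm ?mulgA // -ltnS (ltn_trans _ lt_m).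
have size_take2 k : k <= (size s).+1 -> size (take k.*2 hs) = k.*2.
  by move=> le_k; rewrite size_takel // size_hs leq_double.
have [k [l [lt_kl le_ls Pkl]]] : exists k l, [/\ k < l, l <= size s & P k = P
  l].
  have: ~~ uniq (mkseq P (size s).+1).
    apply/negP => /uniq_leq_size/(_ (fun x _ => finM x)).
    by rewrite size_mkseq ltnn.
  case/(uniqPn (P 0)) => k [l []]; rewrite size_mkseq => lt_kl lt_ls.
  rewrite !nth_mkseq ?(ltn_trans lt_kl) // => eq_kl.
  by exists k, l; rewrite -ltnS.
have [le_ks le_l1] : k <= (size s).+1 /\ l <= (size s).+1 by lia.
pose w := alt e f (drop k.*2 (take l.*2 hs)).
have Pw : P k = P k * w.
  rewrite {1}Pkl /P -[in LHS](cat_take_drop k.*2 (take l.*2 hs)).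
  rewrite take_takel ?leq_double ?(ltnW lt_kl) // alt_cat //.
  by rewrite size_take2 ?odd_double.
(* As w = e h f h' q, each of these five factors occurs twice in w w. Their values may thus be
   squared, and then e and f are absorbed. *)
have gef : w * w * e * f = w * w.
  rewrite /w; have : 1 < size (drop k.*2 (take l.*2 hs)).
    by rewrite size_drop size_take2 //; lia.
  case: (drop _ _) => [|h [|h' r]] //= _; set q := alt e f r.
  pose u := [:: 0; 1; 2; 3; 4; 0; 1; 2; 3; 4]%N.
  pose phi := nth 1 [:: e; h; f; h'; q].
  have -> : e * h * (f * h' * q) * (e * h * (f * h' * q)) =
      eval (square_off pred0 phi) u.
    rewrite -(eval_square_off bM) => [|z]; first by rewrite !evalE.
    by rewrite !inE; do 9?case/predU1P=> [->//|]; move/eqP->.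
  have id_u z : z \in u -> idem (square_off pred0 phi z).
    by move=> _; apply: idem_square_off.
  have -> : e = square_off pred0 phi 0 by rewrite /square_off /= ee.
  have -> : f = square_off pred0 phi 2 by rewrite /square_off /= ff.
  by rewrite !eval_absorb.
(* Because P k = P k w w, the prefix also absorbs e f, and this is the left factor that [sigma_inf]
   requires. *)
have Pef : P k * e * f = P k.
  have Pg : P k * (w * w) = P k by rewrite mulgA -!Pw.
  by rewrite -[in LHS]Pg -!(mulgA (P k)) gef Pg.
rewrite -(cat_take_drop k.*2 hs) alt_cat ?size_take2 ?odd_double //.
rewrite -/(P k) -Pef -!(mulgA (P k)); congr (_ * _).
exact: sM.
Qed.

(** * Cross subvarieties and finite generation *)

Theorem proposition5p11 :
  [/\ hereditarily_finitely_based EE1,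
      (forall V : monoid_class,
         proper_subvariety V EE1_sigma_infty -> cross V)
    & [/\ subvariety EE1_sigma_infty EE1,
          ~ finitely_generated EE1_sigma_infty
        & forall V : monoid_class,
            subvariety V EE1 -> ~ finitely_generated V ->
            same_class V EE1_sigma_infty]].
Proof.
have var_sigma : is_variety EE1_sigma_infty.
  exact/is_variety_defined_within/is_variety_generated.
(* If no sigma_n holds, the only separating identity left is sigma_oo, which holds in V or does
   not. *)
have unbounded V : subvariety V EE1 -> (forall n, ~~ holds V (id_sigma n)) ->
    same_class V EE1 \/ same_class V EE1_sigma_infty.
  move=> [varV subV] unb; have bV M : V M -> basic M by move/subV/EE1P.
  have := unbounded_base varV bV unb; rewrite [filter _ _]/=; case: ifP => V_inf
    base.
    right=> M; split=> [VM|[/EE1P bM M_inf]].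
      by split; [apply: subV | move/asboolP: V_inf; apply].
    by apply/base => e; rewrite mem_cat mem_seq1 => /orP[/bM//|/eqP->].
  left=> M; split=> [/subV//|/EE1P bM].
  by apply/base => e; rewrite cats0 => /bM.
have bounded V n : subvariety V EE1 -> holds V (id_sigma n) ->
    small V /\ finitely_generated V.
  move=> [varV subV] Vn; have bV M : V M -> basic M by move/subV/EE1P.
  by have smallV := bounded_small bV Vn; split=> //; apply:
    small_finitely_generated.
have sub_sigma : subvariety EE1_sigma_infty EE1 by split=> // M [].
split; first exact: EE1_hereditarily_finitely_based.
  move=> V [[varV subV] neqV].
  have subV1 : subvariety V EE1 by split=> // M /subV[].
  have [[n Vn]|unb] := pselect (exists n, holds V (id_sigma n)).
    have [smallV fgV] := bounded V n subV1 Vn.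
    by split=> //; apply: EE1_hereditarily_finitely_based.
  have [n|EV|//] := unbounded V subV1; first by apply/negP => Vn; apply: unb;
    exists n.
  have /EV/subV[_] : EE1 E1 by move=> W _.
  by move/E1_not_sigma_infty.
split=> // [[M finM genM]|V subV nfgV].
  (* A finite generator would satisfy some sigma_n, and with it the whole variety, including the
     automaton monoid that fails sigma_n. *)
  have /genM[/EE1P bM M_inf] : generated_variety M M by move=> W _.
  have [n Mn] := finite_sigma bM finM (proj1 (satisfies_sigma_inf bM) M_inf).
  have /genM gen_aut : EE1_sigma_infty (automaton_monoid n).
    by split; [apply/EE1P/automaton_basic | apply: automaton_sigma_infty].
  apply: (@automaton_sigma n).
  have: models (eq (id_sigma n)) (automaton_monoid n).
    apply: gen_aut; first by exists (eq (id_sigma n)).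
    by move=> _ <-; apply/satisfies_sigma.
  exact.
have [n|EV|//] := unbounded V subV.
  by apply/negP => Vn; have [_] := bounded V n subV Vn.
by case: nfgV; apply: same_finitely_generated EV EE1_finitely_generated.
Qed.
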